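(* Let $a\in\mathbb{R}$ and $\sigma>0$, $\sigma\neq 1$. For each $n\in\mathbb{N}$ let $Z_1,Z_2,\dots$ be i.i.d. random variables with distribution function $$F_{a,\sigma}(x)=\tfrac12\Phi(x)+\tfrac12\Phi\Bigl(\frac{x-\sqrt{n}\,a}{\sigma}\Bigr),$$ and for $\beta>0$ let $$\mathcal{S}_n(\beta)=\sum_{j=1}^{\lfloor e^n\rfloor}e^{\beta\sqrt{n}\,Z_j}.$$ Define $$\beta^+=\begin{cases}\sqrt{2}/\sigma, & \text{if } a>(1-\sigma^2)/(\sqrt{2}\,\sigma),\\[2pt] \dfrac{2a}{1-\sigma^2}, & \text{if } (1-\sigma^2)/\sqrt{2}<a<(1-\sigma^2)/(\sqrt{2}\,\sigma),\\[2pt] \sqrt{2}, & \text{if } a<(1-\sigma^2)/\sqrt{2}.\end{cases}$$ If $(a,\sigma)$ belongs to one of these three regions and $0<\beta<\beta^+/2$, then $$\frac{\mathcal{S}_n(\beta)-\mathbb{E}[\mathcal{S}_n(\beta)]}{\sqrt{\operatorname{Var}(\mathcal{S}_n(\beta))}}\ \xrightarrow{d}\ \mathcal{N}(0,1),\qquad n\to\infty.$$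
   Context: $\Phi$ is the distribution function of the standard normal law; $\xrightarrow{d}$ denotes convergence in distribution; $\mathcal{N}(0,1)$ is the standard normal law. The common law of the $Z_j$ depends on $n$ (a triangular array). *)

(* Defs.v *)
From HB Require Import structures.
From mathcomp Require Export all_boot all_order all_algebra finmap.
From mathcomp Require Export all_classical all_reals all_analysis measurable_realfun.

Set Implicit Arguments.
Unset Strict Implicit.
Unset Printing Implicit Defensive.

Export Order.TTheory GRing.Theory Num.Theory.
Export numFieldNormedType.Exports.

Local Open Scope classical_set_scope.
Local Open Scope ring_scope.

Definition mutually_independent {R : realType} {I : choiceType}
    {d : measure_display} {T : measurableType d} (P : probability T R)
    (X : I -> {RV P >-> R}) : Prop :=
  forall (J : {fset I}) (B : I -> set R),
    (forall j, j \in J -> measurable (B j)) ->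
    P (\bigcap_(j in [set` J]) (X j @^-1` B j)) =
    (\prod_(j <- J) P (X j @^-1` B j))%E.
Arguments mutually_independent {R I d T} P X.

(* The random variables may live on different probability spaces. *)
Definition cvg_in_distribution {R : realType} {d : nat -> measure_display}
    {T : forall n, measurableType (d n)} (P : forall n, probability (T n) R)
    (X : forall n, {RV (P n) >-> R})
    (mu : probability (measurableTypeR R) R) : Prop :=
  forall x : R, {for x, continuous (fun t : R => mu `]-oo, t]%classic)} ->
    cdf (X n : {RV (P n) >-> R}) x @[n --> \oo] --> mu `]-oo, x]%classic.
Arguments cvg_in_distribution {R d T} P X mu.

Definition standardize {R : realType} {d : measure_display}
    {T : measurableType d} (P : probability T R) (X : {RV P >-> R}) (w : T) : R :=
  (X w - fine ('E_P[X])) / Num.sqrt (fine ('V_P[X])).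
Arguments standardize {R d T} P X w.

Section standardize_measurable.
Context {R : realType} {d : measure_display} {T : measurableType d}.
Variables (P : probability T R) (X : {RV P >-> R}).

Let measurable_standardize : measurable_fun setT (standardize P X).
Proof.
apply: measurable_funM; last exact: measurable_cst.
by apply: measurable_funB; [exact: measurable_funPT|exact: measurable_cst].
Qed.

HB.instance Definition _ :=
  isMeasurableFun.Build _ _ _ _ (standardize P X) measurable_standardize.

End standardize_measurable.

Definition Phi {R : realType} (x : R) : R := fine (normal_prob 0 1 `]-oo, x]).

Definition mixture_cdf {R : realType} (a sigma : R) (n : nat) (x : R) : R :=
  Phi x / 2 + Phi ((x - Num.sqrt n%:R * a) / sigma) / 2.

(* The sequence Z_1, Z_2, ... is indexed from 0. *)
Definition exp_sum {R : realType} {d : measure_display} {T : measurableType d}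
    (n : nat) (beta : R) (Z : nat -> {mfun T >-> R}) (w : T) : R :=
  \sum_(j < Num.truncn (expR n%:R : R)) expR (beta * Num.sqrt n%:R * Z j w).

Section exp_sum_measurable.
Context {R : realType} {d : measure_display} {T : measurableType d}.
Variables (n : nat) (beta : R) (Z : nat -> {mfun T >-> R}).

Let measurable_exp_sum : measurable_fun setT (exp_sum n beta Z).
Proof.
apply: measurable_sum => j; apply: measurableT_comp => //.
by apply: measurable_funM; [exact: measurable_cst|exact: measurable_funPT].
Qed.

HB.instance Definition _ :=
  isMeasurableFun.Build _ _ _ _ (exp_sum n beta Z) measurable_exp_sum.

End exp_sum_measurable.

Section regions.
Context {R : realType} (a sigma : R).

Definition region1 : bool :=
  (1 - sigma ^+ 2) / (Num.sqrt 2 * sigma) < a.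

Definition region2 : bool :=
  (1 - sigma ^+ 2) / Num.sqrt 2 < a < (1 - sigma ^+ 2) / (Num.sqrt 2 * sigma).

Definition region3 : bool := a < (1 - sigma ^+ 2) / Num.sqrt 2.

(* The value 0 outside the three regions is a placeholder. *)
Definition beta_plus : R :=
  if region1 then Num.sqrt 2 / sigma
  else if region2 then 2 * a / (1 - sigma ^+ 2)
  else if region3 then Num.sqrt 2
  else 0.

End regions.

(* Main.v *)
(** A Lyapunov central limit theorem for row-wise i.i.d. triangular arrays is
    obtained from Lindeberg's replacement method: in a normalised sum of N
    independent terms with mean 0 and variance 1/N, the terms are replaced one
    at a time by independent N(0,1/N) variables.  On a smooth test function
    each replacement costs O(E|Y|^p + N^(-3/2)) for any p in [2,3], and the
    rotation invariance of the Gaussian identifies the final expectation.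
    The test functions are steep logistic curves, which approximate the
    indicators of half-lines.

    For the exponentials X = exp(beta sqrt(n) Z) one has
    E X^q = (exp(n rate1 q) + exp(n rate2 q)) / 2, with one quadratic rate for
    each component of the mixture, and the number of terms is about exp(n).
    Writing rate for the maximum of the two, Lyapunov's condition becomes
    1 + rate p < p (1 + rate 2) / 2 for some p > 2.  Both sides agree at p = 2
    for a component that dominates the second moment, and comparing derivatives
    there gives 2 beta^2 < 1 (resp. 2 beta^2 sigma^2 < 1); a strictly dominated
    component imposes nothing.  This is what beta < beta_plus / 2 provides. *)
From HB Require Import structures.
Require Import Defs.
From mathcomp Require Import ring lra.
Set Implicit Arguments.
Unset Strict Implicit.
Unset Printing Implicit Defensive.
Local Open Scope classical_set_scope.
Local Open Scope ring_scope.

(** * Logistic test functions *)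

(** Third moments would not suffice: at [p = 3] the condition for a dominating first component reads
    [3 * beta ^+ 2 < 1], short of the required range, so the exponent must be free to approach 2.
    This is why a single test function needs a Taylor bound valid for all exponents between 2 and 3.
    The spaces [T n] are arbitrary and need not carry auxiliary Gaussian variables. None is
    constructed: at each stage rotation invariance merges the Gaussians introduced so far into one,
    which is integrated against [normal_prob 0 1]. The test functions are nonnegative, so the
    exchanges of integrals are instances of Tonelli's theorem, and independence enters the
    replacement only through a partial sum and the next term. *)

Section mvt.
Context {R : realType}.
Implicit Types (f df : R -> R) (K s t x : R).

Lemma is_derive_shift f (a x t : R) :
  is_derive (x + t) 1 f a -> is_derive t 1 (fun s => f (x + s)) a.
Proof.
move=> H; have := @is_derive1_comp R f (fun s => x + s) t a 1 H.
rewrite mulr1; apply.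
have -> : (fun s => x + s) = (cst x \+ id) by [].
by apply: is_derive_eq; rewrite add0r.
Qed.

Lemma is_deriveB_cst f (a c t : R) :
  is_derive t 1 f a -> is_derive t 1 (fun s => f s - c) a.
Proof.
move=> H; rewrite -[a]subr0.
exact: (@is_deriveB _ _ _ f (cst c)).
Qed.

Lemma mvt0 f df (t : R) : (forall s, is_derive s 1 f (df s)) ->
  exists2 c, `|c| <= `|t| & f t - f 0 = df c * t.
Proof.
move=> H.
have cf : continuous f.
  move=> s; apply: differentiable_continuous; apply/derivable1_diffP.
  by case: (H s).
have [t0|t0] := leP 0 t.
  have [c + E] := @MVT_segment R f df 0 t t0 (fun x _ => H x)
     (continuous_subspaceT cf).
  rewrite in_itv/= => /andP[c0 ct]; exists c; last by rewrite E subr0.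
  by rewrite !ger0_norm// (le_trans c0).
have [c + E] := @MVT_segment R f df t 0 (ltW t0) (fun x _ => H x)
     (continuous_subspaceT cf).
rewrite in_itv/= => /andP[tc c0]; exists c.
  by rewrite !ler0_norm ?lerN2// (ltW t0).
by apply: oppr_inj; rewrite opprB E sub0r mulrN.
Qed.

(** The mean value theorem in place of integration: the factor [1 / (k + 1)] is lost, but remainders
    can be bounded one derivative at a time. The bound on [df] is only asked on [|s| <= |t|], so
    that it may depend on [t]. *)
Lemma norm_le_of_derive f df (K t : R) k : 0 <= K ->
  (forall s, is_derive s 1 f (df s)) -> f 0 = 0 ->
  (forall s, `|s| <= `|t| -> `|df s| <= K * `|s| ^+ k) -> `|f t| <= K * `|t| ^+ k.+1.
Proof.
move=> K0 H f0 B; have [c ct] := mvt0 t H.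
rewrite f0 subr0 => ->; rewrite normrM exprSr mulrA.
rewrite ler_wpM2r// (le_trans (B c ct))// ler_wpM2l//.
by rewrite lerXn2r// ?nnegrE.
Qed.

(** The second derivative of the remainder is [f2 (x + s) - f2 x], at most [K * |s|] through [f3]
    and at most [2 * K] trivially; two applications of the mean value theorem give the two bounds.
    The cubic one is for small [t], the quadratic one for large [t]. *)
Lemma taylor2 (f f1 f2 f3 : R -> R) K : 0 <= K ->
  (forall s, is_derive s 1 f (f1 s)) -> (forall s, is_derive s 1 f1 (f2 s)) ->
  (forall s, is_derive s 1 f2 (f3 s)) ->
  (forall s, `|f2 s| <= K) -> (forall s, `|f3 s| <= K) ->
  forall x t, `|f (x + t) - f x - t * f1 x - t ^+ 2 / 2 * f2 x| <= K * `|t| ^+ 3 /\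
    `|f (x + t) - f x - t * f1 x - t ^+ 2 / 2 * f2 x| <= 2 * K * `|t| ^+ 2.
Proof.
move=> K0 H0 H1 H2 B2 B3 x t.
have D2 s : is_derive s 1 (fun s => f2 (x + s) - f2 x) (f3 (x + s)).
  by apply: is_deriveB_cst; apply: is_derive_shift.
have D1 s : is_derive s 1 (fun s => f1 (x + s) - f1 x - s * f2 x) (f2 (x + s) - f2 x).
  apply: (@is_deriveB _ _ _ (fun s => f1 (x + s) - f1 x) (fun s => s * f2 x)).
    by apply: is_deriveB_cst; apply: is_derive_shift.
  have -> : (fun s => s * f2 x) = (f2 x \*: id) by apply/funext => u /=; rewrite mulrC.
  by apply: is_derive_eq; rewrite /GRing.scale /= mulr1.
have D0 s : is_derive s 1 (fun s => f (x + s) - f x - s * f1 x - s ^+ 2 / 2 * f2 x)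
    (f1 (x + s) - f1 x - s * f2 x).
  apply: (@is_deriveB _ _ _ (fun s => f (x + s) - f x - s * f1 x)
    (fun s => s ^+ 2 / 2 * f2 x)).
    apply: (@is_deriveB _ _ _ (fun s => f (x + s) - f x) (fun s => s * f1 x)).
      by apply: is_deriveB_cst; apply: is_derive_shift.
    have -> : (fun s => s * f1 x) = (f1 x \*: id) by apply/funext => u /=; rewrite mulrC.
    by apply: is_derive_eq; rewrite /GRing.scale /= mulr1.
  have -> : (fun s => s ^+ 2 / 2 * f2 x) = ((f2 x / 2) \*: (id ^+ 2)).
    by apply/funext => u /=; rewrite /GRing.scale/= exprfctE; lra.
  by apply: is_derive_eq; rewrite /GRing.scale /=; lra.
have B2' s : `|f2 (x + s) - f2 x| <= K * `|s| ^+ 1.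
  apply: (@norm_le_of_derive (fun s => f2 (x + s) - f2 x) (fun s => f3 (x + s))) => //.
    by rewrite addr0 subrr.
  by move=> u _; rewrite expr0 mulr1.
have B1' s : `|f1 (x + s) - f1 x - s * f2 x| <= K * `|s| ^+ 2.
  apply: (@norm_le_of_derive (fun s => f1 (x + s) - f1 x - s * f2 x)) D1 _ _ => //.
  by rewrite addr0 subrr mul0r subrr.
have B1'' s : `|f1 (x + s) - f1 x - s * f2 x| <= 2 * K * `|s| ^+ 1.
  apply: (@norm_le_of_derive (fun s => f1 (x + s) - f1 x - s * f2 x)) D1 _ _ => //.
  - by rewrite mulr_ge0.
  - by rewrite addr0 subrr mul0r subrr.
  - move=> u _; rewrite expr0 mulr1 mulr_natl mulr2n.
    by rewrite (le_trans (ler_normB _ _))// lerD.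
split; apply: (@norm_le_of_derive
    (fun s => f (x + s) - f x - s * f1 x - s ^+ 2 / 2 * f2 x)) D0 _ _ => //.
- by rewrite addr0 subrr; lra.
- by rewrite mulr_ge0.
- by rewrite addr0 subrr; lra.
Qed.

End mvt.

Section logistic.
Context {R : realType}.

Implicit Types lam c y : R.

(** For [lam > 0], a smoothed indicator of the half-line up to [c]. It solves
    [g' = lam * (g ^+ 2 - g)], so each derivative is a polynomial in [g], bounded because
    [0 < g <= 1]. *)
Definition logistic lam c y : R := (1 + expR (lam * (y - c)))^-1.

Lemma logistic_gt0 lam c y : 0 < logistic lam c y.
Proof. by rewrite invr_gt0 addr_gt0 ?expR_gt0. Qed.

Lemma logistic_le1 lam c y : logistic lam c y <= 1.
Proof. by rewrite invf_le1 ?lerDl ?expR_ge0// addr_gt0 ?expR_gt0. Qed.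

Lemma is_derive_logistic lam c y :
  is_derive y 1 (logistic lam c) (lam * (logistic lam c y ^+ 2 - logistic lam c y)).
Proof.
pose g (y : R) : R := 1 + expR (lam * (y - c)).
have E0 : g y != 0 by rewrite gt_eqF// addr_gt0 ?expR_gt0.
have H : is_derive y 1 g (expR (lam * (y - c)) * lam).
  have -> : g = cst 1 \+ (expR \o (lam \*: (id \- cst c))) by [].
  by apply: is_derive_eq; rewrite /GRing.scale/= subr0 mulr1 add0r.
have dH := @ex_derive _ _ _ _ _ _ _ H.
have -> : logistic lam c = (fun y => (g y)^-1) by [].
have HV := @derivableV R R g y 1 E0 dH.
apply: (DeriveDef HV).
rewrite (@deriveV R R g y 1 E0 dH) (@derive_val _ _ _ _ _ _ _ H).
rewrite /GRing.scale/=.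
have -> : expR (lam * (y - c)) = g y - 1 by rewrite /g; ring.
by field.
Qed.

Definition logistic1 lam c y : R := lam * (logistic lam c y ^+ 2 - logistic lam c y).
Definition logistic2 lam c y : R :=
  lam ^+ 2 * (2 * logistic lam c y ^+ 3 - 3 * logistic lam c y ^+ 2 + logistic lam c y).
Definition logistic3 lam c y : R :=
  lam ^+ 3 * ((6 * logistic lam c y ^+ 2 - 6 * logistic lam c y + 1) *
    (logistic lam c y ^+ 2 - logistic lam c y)).

(** [|t| ^ p] dominates [|t| ^ 3] for [|t| <= 1] and [|t| ^ 2] for [|t| > 1]. The constant is
    uniform in [p], as the replacement uses two exponents with the same test function. *)
Lemma logistic_taylor lam c : exists C, 0 <= C /\
  forall p x t, 2 <= p <= 3 ->
  `|logistic lam c (x + t) - logistic lam c x - t * logistic1 lam c x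
     - t ^+ 2 / 2 * logistic2 lam c x| <= C * `|t| `^ p.
Proof.
have H1 (s : R) : is_derive s 1 (logistic lam c) (logistic1 lam c s).
  exact: is_derive_logistic.
have H2 (s : R) : is_derive s 1 (logistic1 lam c) (logistic2 lam c s).
  have -> : logistic1 lam c = lam \*: (logistic lam c ^+ 2 - logistic lam c) by [].
  apply: is_derive_eq; rewrite /GRing.scale/= /logistic2 /logistic1; ring.
have H3 (s : R) : is_derive s 1 (logistic2 lam c) (logistic3 lam c s).
  have -> : logistic2 lam c =
    (lam ^+ 2) \*: (2 \*: (logistic lam c ^+ 3) - 3 \*: (logistic lam c ^+ 2)
      + logistic lam c) by [].
  apply: is_derive_eq; rewrite /GRing.scale/= /logistic3 /logistic1; ring.
pose K := `|lam| ^+ 2 + `|lam| ^+ 3.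
have K0 : 0 <= K by rewrite addr_ge0// exprn_ge0.
have B2 s : `|logistic2 lam c s| <= K.
  rewrite /logistic2 normrM normrX /K.
  have := logistic_gt0 lam c s; have := logistic_le1 lam c s.
  set g := logistic _ _ _ => g1 g0.
  rewrite -[leLHS]addr0 lerD ?exprn_ge0// ler_piMr ?exprn_ge0// ler_norml.
  by apply/andP; split; nra.
have B3 s : `|logistic3 lam c s| <= K.
  rewrite /logistic3 normrM normrX /K.
  have := logistic_gt0 lam c s; have := logistic_le1 lam c s.
  set g := logistic _ _ _ => g1 g0.
  rewrite -[leLHS]add0r lerD ?exprn_ge0// ler_piMr ?exprn_ge0//.
  rewrite normrM -[leRHS]mulr1 ler_pM//  ler_norml; apply/andP; split; nra.
exists (2 * K); split; first by rewrite mulr_ge0.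
move=> p x t /andP[p2 p3].
have [T3 T2] := taylor2 K0 H1 H2 H3 B2 B3 x t.
have [->|t0] := eqVneq t 0.
  by rewrite addr0 subrr !mul0r expr0n/= !mul0r !subrr normr0 mulr_ge0 ?powR_ge0// mulr_ge0.
have tn0 : 0 < `|t| by rewrite normr_gt0.
have [t1|t1] := leP `|t| 1.
  apply: (le_trans T3); apply: (@le_trans _ _ (2 * K * `|t| ^+ 3)).
    by rewrite ler_wpM2r ?exprn_ge0//; lra.
  rewrite ler_wpM2l ?mulr_ge0// -powR_mulrn// ger_powR// tn0 t1//.
apply: (le_trans T2); rewrite ler_wpM2l ?mulr_ge0// -powR_mulrn// ler_powR//.
exact: ltW.
Qed.

End logistic.

(** * The standard Gaussian measure *)

Section density.
Context {R : realType} {d : measure_display} {T : measurableType d}.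
Variables (mu nu : {measure set T -> \bar R}) (g : T -> R).
Hypotheses (mg : measurable_fun setT g) (g0 : forall x, 0 <= g x).
Hypothesis nuE : forall A, measurable A -> nu A = (\int[mu]_(x in A) (g x)%:E)%E.

Import HBNNSimple.

Let mulg0 (h : T -> R) x : (forall x, 0 <= h x) -> (0 <= (h x)%:E * (g x)%:E)%E.
Proof. by move=> h0; rewrite mule_ge0// lee_fin. Qed.

Let density_nnsfun (h : {nnsfun T >-> R}) :
  (\int[nu]_x (h x)%:E = \int[mu]_x ((h x)%:E * (g x)%:E))%E.
Proof.
under [LHS]eq_integral do rewrite fimfunE -fsumEFin//.
rewrite [LHS]ge0_integral_fsum//; last 2 first.
  - by move=> r; exact/measurable_EFinP/measurableT_comp.
  - by move=> n x _; rewrite EFinM nnfun_muleindic_ge0.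
under [RHS]eq_integral.
  move=> x xD; rewrite fimfunE -fsumEFin// muleC ge0_mule_fsumr; last first.
    by move=> r; rewrite EFinM nnfun_muleindic_ge0.
  over.
rewrite [RHS]ge0_integral_fsum//; last 2 first.
  - move=> r; apply: emeasurable_funM; first exact/measurable_EFinP.
    by apply/measurable_EFinP; apply/measurableT_comp.
  - move=> n x _; apply: mule_ge0; first by rewrite lee_fin.
    by rewrite EFinM nnfun_muleindic_ge0.
apply: eq_fsbigr => r _.
rewrite integralZl_indic_nnsfun// integral_indic// setIT nuE//.
have [r0|r0] := ltP r 0.
  rewrite preimage_nnfun0// integral_set0 mule0; apply/esym/integral0_eq => x _.
  by rewrite indicE in_set0 mulr0 mule0.
rewrite integral_mkcond -ge0_integralZl//.
- apply: eq_integral => x _; rewrite EFinM muleCA patchE indicE.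
  by case: ifPn => _; rewrite ?mule1 ?mule0.
- apply: (measurable_restrictT _ _).1 => //.
  by apply/measurable_EFinP; exact: measurable_funTS.
- by move=> x _; rewrite patchE; case: ifPn => //; rewrite lee_fin.
Qed.

Lemma ge0_integral_density (f : T -> \bar R) :
  measurable_fun setT f -> (forall x, 0 <= f x)%E ->
  (\int[nu]_x f x = \int[mu]_x (f x * (g x)%:E))%E.
Proof.
move=> mf f0.
pose f_ := nnsfun_approx measurableT mf.
transitivity (lim (\int[nu]_x (f_ n x)%:E @[n --> \oo])%E).
  rewrite -monotone_convergence//=.
  - apply: eq_integral => x _; apply/esym/cvg_lim => //=.
    exact: cvg_nnsfun_approx.
  - by move=> n; exact/measurable_EFinP/measurable_funTS.
  - by move=> n x _; rewrite lee_fin.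
  - by move=> x _ a b ab; rewrite lee_fin; exact/lefP/nd_nnsfun_approx.
transitivity (lim (\int[mu]_x ((f_ n x)%:E * (g x)%:E) @[n --> \oo])%E).
  by apply: congr_lim; apply/funext => n /=; exact: density_nnsfun.
rewrite -monotone_convergence//=.
- apply: eq_integral => x _; apply/cvg_lim => //=.
  by apply: cvgeZr => //; exact: cvg_nnsfun_approx.
- move=> n; apply: emeasurable_funM; first exact/measurable_EFinP/measurable_funTS.
  exact/measurable_EFinP.
- by move=> n x _; exact: mulg0.
- move=> x _ a b ab; rewrite lee_wpmul2r// ?lee_fin//; exact/lefP/nd_nnsfun_approx.
Qed.

End density.

Local Ltac mtac := repeat first
  [ exact: measurable_id | exact: measurable_cst
  | exact: measurable_fst | exact: measurable_snd
  | apply: measurable_funM | apply: measurable_funD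
  | apply: measurable_funB | apply: measurable_funN
  | match goal with
    | H : context[measurable_fun _ (_ \o _)] |- _ => apply: H
    end ].

Section gauss.
Context {R : realType}.
Local Notation mu := (@lebesgue_measure R).
Local Notation gam := (@normal_prob R 0 1).
Local Notation phi := (@normal_pdf R 0 1).

Lemma ge0_integral_gauss (f : R -> \bar R) :
  measurable_fun setT f -> (forall x, 0 <= f x)%E ->
  (\int[gam]_x f x = \int[mu]_x (f x * (phi x)%:E))%E.
Proof.
move=> mf f0; apply: ge0_integral_density => //.
- exact: measurable_normal_pdf.
- exact: normal_pdf_ge0.
Qed.

Lemma ge0_integral_affine (G : R -> R) (al be : R) : 0 < al ->
  continuous G -> (forall x, 0 <= G x) ->
  (\int[mu]_x (G x)%:E = \int[mu]_x (G (al * x + be) * al)%:E)%E.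
Proof.
move=> al0 cG G0.
pose F (x : R) := al * x + be.
have dF (x : R) : is_derive x 1 F al.
  have -> : F = (al \*: id) \+ cst be by [].
  by apply: is_derive_eq; rewrite /GRing.scale/= mulr1 addr0.
have F'E : F^`()%classic = cst al.
  by apply/funext => x; rewrite derive1E (@derive_val _ _ _ _ _ _ _ (dF x)).
rewrite (@increasing_ge0_integration_by_substitutionT R F G) //.
- by apply: eq_integral => x _; rewrite F'E.
- by move=> x y xy; rewrite /F ltrD2r ltr_pM2l.
- by rewrite F'E => x; exact: cvg_cst.
- by rewrite F'E; exact: is_cvg_cst.
- by rewrite F'E; exact: is_cvg_cst.
- apply/cvgrNyPle => A; exists ((A - be) / al); split; first exact: num_real.
  by move=> x /ltW; rewrite ler_pdivlMr// mulrC lerBrDr.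
- apply/cvgryPge => A; exists ((A - be) / al); split; first exact: num_real.
  by move=> x /ltW; rewrite ler_pdivrMr// mulrC lerBlDr.
Qed.

Lemma phiE x : phi x = normal_peak 1 * expR (- x ^+ 2 / 2).
Proof. by rewrite normal_pdfE ?oner_neq0// /normal_fun subr0 expr1n. Qed.

(** Completing the square turns [expR (t * z)] times the standard density into [expR (t ^+ 2 / 2)]
    times the density of N(t,1). *)
Lemma integral_gauss_expR (t : R) :
  (\int[gam]_z (expR (t * z))%:E = (expR (t ^+ 2 / 2))%:E)%E.
Proof.
rewrite ge0_integral_gauss; last 2 first.
- by apply/measurable_EFinP; apply: measurableT_comp => //; exact: mulrl_measurable.
- by move=> x; rewrite lee_fin expR_ge0.
transitivity (\int[mu]_z ((expR (t ^+ 2 / 2))%:E * (normal_pdf t 1 z)%:E))%E.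
  apply: eq_integral => z _; rewrite -!EFinM phiE normal_pdfE ?oner_neq0// /normal_fun expr1n.
  rewrite mulrCA [in RHS]mulrCA -!expRD; congr (_ * expR _)%:E.
  by rewrite -[1 *+ 2]/(2:R); field.
rewrite ge0_integralZl//.
- by rewrite integral_normal_pdf mule1.
- by apply/measurable_EFinP; exact: measurable_normal_pdf.
- by move=> x _; rewrite lee_fin normal_pdf_ge0.
Qed.

(** Lets the Gaussian part of a partly replaced sum absorb one more term. Only [s] must be positive,
    since [c = 0] occurs when the first Gaussian enters. *)
Lemma gauss_rotation (f : R -> R) (x c s : R) : 0 < s -> continuous f ->
  (forall y, 0 <= f y) ->
  (\int[gam]_y \int[gam]_z (f (x + c * y + s * z))%:E =
   \int[gam]_w (f (x + Num.sqrt (c ^+ 2 + s ^+ 2) * w))%:E)%E.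
Proof.
move=> s0 cf f0.
set r := Num.sqrt _.
have r2 : r ^+ 2 = c ^+ 2 + s ^+ 2 by rewrite sqr_sqrtr// addr_ge0// sqr_ge0.
have r0 : 0 < r by rewrite sqrtr_gt0 ltr_wpDl ?sqr_ge0// exprn_gt0.
have mf : measurable_fun setT f by exact: continuous_measurable_fun.
have phi0 y : 0 <= phi y by exact: normal_pdf_ge0.
have cphi : continuous phi by apply: continuous_normal_pdf; rewrite oner_neq0.
have mphi : measurable_fun setT phi by exact: measurable_normal_pdf.
have clin (a b : R) : continuous (fun z : R => a + b * z).
  by move=> z; apply: cvgD; [exact: cvg_cst|apply: cvgM; [exact: cvg_cst|exact: cvg_id]].
have mfc := measurableT_comp mf; have mphic := measurableT_comp mphi.
(* The substitution [z = (r w - c y) / s] turns [y^2 + z^2] into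
   [w^2 + ((r y - c w) / s)^2]. *)
transitivity (\int[mu]_y \int[mu]_w
    (f (x + r * w) * phi w * (phi (r / s * y + - (c * w / s)) * (r / s)))%:E)%E.
  rewrite ge0_integral_gauss; last 2 first.
  - apply: (@measurable_fun_fubini_tonelli_F _ _ _ _ _ gam
       (fun yz : measurableTypeR R * measurableTypeR R =>
         (f (x + c * yz.1 + s * yz.2))%:E)); last by move=> z; rewrite lee_fin.
    apply/measurable_EFinP; apply: measurableT_comp => //.
    by apply: measurable_funD; [apply: measurable_funD => //|];
      apply: measurable_funM => //; exact: measurable_cst.
  - by move=> y; apply: integral_ge0 => z _; rewrite lee_fin.
  apply: eq_integral => y _.
  rewrite ge0_integral_gauss; last 2 first.
  - apply/measurable_EFinP; apply: measurableT_comp => //.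
    by apply: measurable_funD => //; apply: measurable_funM => //; exact: measurable_cst.
  - by move=> z; rewrite lee_fin.
  under eq_integral do rewrite -EFinM.
  rewrite (@ge0_integral_affine _ (r / s) (- (c * y / s))); last 3 first.
  - by rewrite divr_gt0.
  - move=> z; apply: cvgM; last exact: cphi.
    exact: (continuous_comp (clin (x + c * y) s z) (cf _)).
  - by move=> z; rewrite mulr_ge0.
  rewrite -ge0_integralZr//; last 3 first.
  - by apply/measurable_EFinP; mtac.
  - by move=> z _; rewrite lee_fin !mulr_ge0// ?ltW// invr_gt0.
  - by rewrite lee_fin.
  apply: eq_integral => w _; rewrite -EFinM; congr _%:E.
  have -> : x + c * y + s * (r / s * w + - (c * y / s)) = x + r * w.
    by field; rewrite gt_eqF.
  have E : phi (r / s * w + - (c * y / s)) * phi y =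
     phi w * phi (r / s * y + - (c * w / s)).
    rewrite !phiE mulrACA -expRD [RHS]mulrACA -expRD; congr (_ * expR _).
    by field: r2; rewrite gt_eqF.
  have -> : f (x + r * w) * phi (r / s * w + - (c * y / s)) * (r / s) * phi y =
     f (x + r * w) * (phi (r / s * w + - (c * y / s)) * phi y) * (r / s) by ring.
  by rewrite E; ring.
rewrite (@fubini_tonelli _ _ _ _ _ mu mu (fun yw : measurableTypeR R * measurableTypeR R =>
  (f (x + r * yw.2) * phi yw.2 *
    (phi (r / s * yw.1 + - (c * yw.2 / s)) * (r / s)))%:E))/=; last 2 first.
- by apply/measurable_EFinP; mtac.
- by move=> [y w]; rewrite lee_fin !mulr_ge0// ?ltW// invr_gt0.
rewrite ge0_integral_gauss; last 2 first.
- by apply/measurable_EFinP; mtac.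
- by move=> z; rewrite lee_fin.
apply: eq_integral => w _; rewrite -EFinM.
under eq_integral do rewrite EFinM.
rewrite ge0_integralZl//; last 3 first.
- by apply/measurable_EFinP; mtac.
- by move=> z _; rewrite lee_fin !mulr_ge0// ?ltW// invr_gt0.
- by rewrite lee_fin mulr_ge0.
(* For fixed [w] the integrand in [y] is a Gaussian density after an affine change of variable, so
   it integrates to 1. *)
rewrite -(@ge0_integral_affine phi (r / s) (- (c * w / s)))//; last by rewrite divr_gt0.
by rewrite integral_normal_pdf mule1.
Qed.

End gauss.

(** * Elementary inequalities for the exponential and the hyperbolic cosine *)

Section exp_bounds.
Context {R : realType}.
Implicit Types s t u z x : R.

Lemma expR_norm_le s : expR `|s| <= expR s + expR (- s).
Proof.
have [s0|s0] := leP 0 s; first by rewrite ger0_norm// lerDl expR_ge0.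
by rewrite ltr0_norm// lerDr expR_ge0.
Qed.

(** For [k > 0], raise [|z| / k <= expR (|z| / k)] to the power [k]. *)
Lemma exprn_le_expR z k : `|z| ^+ k <= k%:R ^+ k * expR `|z|.
Proof.
case: k => [|k]; first by rewrite !expr0 mul1r -expR0 ler_expR.
have k0 : 0 < k.+1%:R :> R by rewrite ltr0n.
have -> : expR `|z| = expR (`|z| / k.+1%:R) ^+ k.+1.
  by rewrite -expRM_natr -mulrA mulVf ?mulr1// gt_eqF.
rewrite -exprMn lerXn2r ?nnegrE// ?mulr_ge0 ?expR_ge0//.
rewrite mulrC -ler_pdivrMr// (le_trans _ (expR_ge1Dx _))// lerDr//.
Qed.

Lemma expR_le_inv x : x < 1 -> expR x <= (1 - x)^-1.
Proof.
move=> x1; rewrite -[x in leLHS]opprK expRN lef_pV2 ?posrE ?expR_gt0 ?subr_gt0//.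
exact: expR_ge1Dx.
Qed.

Let isd (k : R) s : is_derive s 1 (fun s => expR (k * s)) (k * expR (k * s)).
Proof.
have -> : (fun s => expR (k * s)) = expR \o (k \*: id) by [].
by apply: is_derive_eq; rewrite /GRing.scale/= mulr1 mulrC.
Qed.

#[local] Existing Instance isd.

(** The difference [expR s + expR (- s) - 2] is the square of [expR (s / 2) - expR (- (s / 2))],
    whose modulus is at least [|s|] by the mean value theorem. *)
Lemma coshm1_ge s : 2 + s ^+ 2 <= expR s + expR (- s).
Proof.
have H u : 2 * `|u| <= `|expR (1 * u) - expR (- 1 * u)|.
  have D t : is_derive t 1 (fun t => expR (1 * t) - expR (-1 * t)) (expR t + expR (- t)).
    have := @is_deriveB _ _ _ (fun t => expR (1 * t)) (fun t => expR (-1 * t)) t 1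
      _ _ (isd 1 t) (isd (-1) t).
    by rewrite !mul1r !mulN1r opprK.
  have [c _ E] := mvt0 u D.
  rewrite !mulr0 subrr subr0 in E; rewrite E normrM ler_wpM2r//.
  rewrite ger0_norm ?addr_ge0 ?expR_ge0//.
  by have := expR_ge1Dx c; have := expR_ge1Dx (- c); lra.
have := H (s / 2); rewrite mul1r mulN1r.
rewrite -(ler_sqr _ _) ?nnegrE ?mulr_ge0//.
rewrite exprMn !real_normK ?num_real//.
have E1 : expR (s / 2) ^+ 2 = expR s by rewrite -expRM_natr -mulrA mulVf ?mulr1.
have E2 : expR (- (s / 2)) ^+ 2 = expR (- s) by rewrite -expRM_natr mulNr -mulrA mulVf ?mulr1.
have E3 : expR (s / 2) * expR (- (s / 2)) = 1 by rewrite -expRD subrr expR0.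
by rewrite sqrrB E1 E2 E3; lra.
Qed.

(** The left-hand side vanishes at 0 with its first three derivatives, and its fourth derivative is
    at most [2 * expR |s|] between [-|s|] and [|s|]. *)
Lemma coshm1_le s : expR s + expR (- s) - 2 - s ^+ 2 <= 2 * expR `|s| * `|s| ^+ 4.
Proof.
pose h t := expR (1 * t) + expR (-1 * t) - 2 - t ^+ 2.
pose h1 t := expR (1 * t) - expR (-1 * t) - 2 * t.
pose h2 t := expR (1 * t) + expR (-1 * t) - 2.
pose h3 t := expR (1 * t) - expR (-1 * t).
pose h4 t := expR (1 * t) + expR (-1 * t).
have D3 t : is_derive t 1 h3 (h4 t).
  have -> : h3 = (fun t => expR (1 * t)) - (fun t => expR (-1 * t)) by [].
  apply: is_derive_eq; rewrite /h4; lra.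
have D2 t : is_derive t 1 h2 (h3 t).
  have -> : h2 = (fun t => expR (1 * t)) + (fun t => expR (-1 * t)) - cst 2 by [].
  apply: is_derive_eq; rewrite /h3; lra.
have D1 t : is_derive t 1 h1 (h2 t).
  have -> : h1 = (fun t => expR (1 * t)) - (fun t => expR (-1 * t)) - (2 \*: id) by [].
  apply: is_derive_eq; rewrite /h2 /h4 /GRing.scale/=; lra.
have D0 t : is_derive t 1 h (h1 t).
  have -> : h = (fun t => expR (1 * t)) + (fun t => expR (-1 * t)) - cst 2 - id ^+ 2 by [].
  apply: is_derive_eq; rewrite /h1 /h3 /GRing.scale/= ?expr1; lra.
pose K := 2 * expR `|s|.
have K0 : 0 <= K by rewrite mulr_ge0 ?expR_ge0.
have B4 t : `|t| <= `|s| -> `|h4 t| <= K * `|t| ^+ 0.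
  move=> ts; rewrite expr0 mulr1 /h4 mul1r mulN1r ger0_norm ?addr_ge0 ?expR_ge0//.
  rewrite /K mulr_natl mulr2n lerD// ler_expR (le_trans _ ts)// ?ler_norm//.
  by rewrite -normrN ler_norm.
have B3 t : `|t| <= `|s| -> `|h3 t| <= K * `|t| ^+ 1.
  move=> ts; apply: (@norm_le_of_derive _ h3 h4 K t 0) => //.
    by rewrite /h3 !mulr0 subrr.
  by move=> u ut; apply: B4; exact: le_trans ts.
have B2 t : `|t| <= `|s| -> `|h2 t| <= K * `|t| ^+ 2.
  move=> ts; apply: (@norm_le_of_derive _ h2 h3 K t 1) => //.
    by rewrite /h2 !mulr0 expR0; lra.
  by move=> u ut; apply: B3; exact: le_trans ts.
have B1 t : `|t| <= `|s| -> `|h1 t| <= K * `|t| ^+ 3.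
  move=> ts; apply: (@norm_le_of_derive _ h1 h2 K t 2) => //.
    by rewrite /h1 !mulr0 expR0; lra.
  by move=> u ut; apply: B2; exact: le_trans ts.
have B0 : `|h s| <= K * `|s| ^+ 4.
  apply: (@norm_le_of_derive _ h h1 K s 3) => //.
    by rewrite /h !mulr0 expR0; lra.
by apply: le_trans B0; rewrite (le_trans _ (ler_norm _))// /h mul1r mulN1r.
Qed.

End exp_bounds.

Lemma Rintegral_cst_prob {R : realType} {d : measure_display} {T : measurableType d}
  (P : probability T R) (r : R) : \int[P]_z r = r.
Proof.
rewrite Rintegral_cst// [X in fine X](_ : _ = 1%E) ?mulr1 //.
exact: probability_setT.
Qed.

(** * Integrability, mean and variance of the standard Gaussian *)

Section gauss_moments.
Context {R : realType}.
Local Notation gam := (@normal_prob R 0 1).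

Lemma integrable_gauss_expR (t : R) :
  gam.-integrable setT (EFin \o (fun z => expR (t * z))).
Proof.
apply/integrableP; split.
  by apply/measurable_EFinP; apply: measurableT_comp => //; exact: mulrl_measurable.
under eq_integral do rewrite /= ger0_norm ?expR_ge0//.
by rewrite integral_gauss_expR ltry.
Qed.

Lemma integrable_gauss_dom (C a : R) (f : R -> R) : measurable_fun setT f ->
  (forall z, `|f z| <= C * expR (a * `|z|)) -> 0 <= a -> 0 <= C ->
  gam.-integrable setT (EFin \o f).
Proof.
move=> mf B a0 C0.
have I : gam.-integrable setT
    (EFin \o (fun z => C * (expR (a * z) + expR (- a * z)))).
  rewrite (_ : _ \o _ = (fun z => C%:E * ((expR (a * z))%:E + (expR (- a * z))%:E)))%E//.
  apply: integrableZl => //; apply: integrableD => //; exact: integrable_gauss_expR.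
apply: le_integrable I => //; first exact/measurable_EFinP.
move=> z _; rewrite lee_fin (le_trans (B z))// ger0_norm ?mulr_ge0 ?addr_ge0 ?expR_ge0//.
have -> : a * `|z| = `|a * z| by rewrite normrM (ger0_norm a0).
by rewrite ler_wpM2l// mulNr; exact: expR_norm_le.
Qed.

Lemma integrable_gauss_exprn k : gam.-integrable setT (EFin \o (fun z : R => z ^+ k)).
Proof.
apply: (@integrable_gauss_dom (k%:R ^+ k) 1) => //.
by move=> z; rewrite normrX mul1r exprn_le_expR.
Qed.

Lemma integrable_gauss_norm_exprn k : gam.-integrable setT (EFin \o (fun z : R => `|z| ^+ k)).
Proof.
apply: (@integrable_gauss_dom (k%:R ^+ k) 1) => //.
  exact: (measurableT_comp (@exprn_measurable _ _ k)).
by move=> z; rewrite normrX normr_id mul1r exprn_le_expR.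
Qed.

Lemma Rintegral_gauss_expR (t : R) : \int[gam]_z expR (t * z) = expR (t ^+ 2 / 2).
Proof. by rewrite /Rintegral integral_gauss_expR. Qed.

Lemma Rintegral_gauss_cst (r : R) : \int[gam]_z r = r.
Proof. exact: (Rintegral_cst_prob gam). Qed.

Let icst (r : R) : gam.-integrable setT (EFin \o (fun=> r)).
Proof. exact: finite_measure_integrable_cst. Qed.

Let iexp (t : R) : gam.-integrable setT (EFin \o (fun z : R => expR (t * z))).
Proof. exact: integrable_gauss_expR. Qed.

(** Integrate [1 + t * z <= expR (t * z)] and use [expR (t ^+ 2 / 2) <= 1 + t ^+ 2]. Small [t] of
    either sign then squeeze the mean. *)
Let gauss_mean_le (t : R) : `|t| <= 1 -> t * (\int[gam]_z z) <= t ^+ 2.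
Proof.
move=> t1.
have i1 : gam.-integrable setT (EFin \o (fun z : R => z)) by exact: (integrable_gauss_exprn 1).
have itz : gam.-integrable setT (EFin \o (fun z : R => t * z)).
  by rewrite (_ : _ \o _ = (fun z => t%:E * z%:E))%E//; apply: integrableZl.
rewrite -RintegralZl//.
have : \int[gam]_z (1 + t * z) <= expR (t ^+ 2 / 2).
  rewrite -Rintegral_gauss_expR; apply: le_Rintegral => //.
    rewrite (_ : _ \o _ = (fun z => 1%:E + (t * z)%:E))%E//.
    by apply: integrableD => //; exact: (icst 1).
  by move=> z _; exact: expR_ge1Dx.
rewrite RintegralD// Rintegral_gauss_cst => H.
have t2 : t ^+ 2 <= 1 by rewrite -real_normK ?num_real// expr_le1.
have := @expR_le_inv R (t ^+ 2 / 2).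
have : (1 - t ^+ 2 / 2)^-1 <= 1 + t ^+ 2.
  rewrite -[leRHS]invrK lef_pV2 ?posrE ?invr_gt0; [|lra|nra].
  by rewrite -[leLHS]mul1r ler_pdivrMr; nra.
lra.
Qed.

(* Mean and variance are read off the moment generating function
   [exp (t^2 / 2)] by letting [t] tend to 0. *)
Lemma gauss_mean : \int[gam]_z z = 0 :> R.
Proof.
apply/eqP; rewrite eq_le; apply/andP; split.
  apply/ler_addgt0Pl => e e0; rewrite addr0.
  pose t := Num.min e 1.
  have t0 : 0 < t by rewrite lt_min e0 ltr01.
  have := @gauss_mean_le t; rewrite gtr0_norm// ge_min lexx orbT => /(_ isT).
  rewrite expr2 ler_pM2l// => /le_trans; apply; by rewrite ge_min lexx.
rewrite -subr_le0 sub0r.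
apply/ler_addgt0Pl => e e0; rewrite addr0.
pose t := Num.min e 1.
have t0 : 0 < t by rewrite lt_min e0 ltr01.
have := @gauss_mean_le (- t); rewrite normrN gtr0_norm// ge_min lexx orbT => /(_ isT).
rewrite mulNr -mulrN sqrrN expr2 ler_pM2l// => /le_trans; apply; by rewrite ge_min lexx.
Qed.

Lemma gauss_var : \int[gam]_z (z ^+ 2) = 1 :> R.
Proof.
set V := Rintegral _ _ _.
have i2 := integrable_gauss_exprn 2.
have it2 (t : R) : gam.-integrable setT (EFin \o (fun z : R => t * z ^+ 2)).
  by rewrite (_ : _ \o _ = (fun z => t%:E * (z ^+ 2)%:E))%E//; apply: integrableZl.
have it2' (t : R) : gam.-integrable setT (EFin \o (fun z : R => 2 + t * z ^+ 2)).
  rewrite (_ : _ \o _ = (fun z => 2%:E + (t * z ^+ 2)%:E))%E//.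
  by apply: integrableD => //; first [exact: (icst 2)|exact: (it2 t)].
have icosh (t : R) :
    gam.-integrable setT (EFin \o (fun z : R => expR (t * z) + expR (- t * z))).
  rewrite (_ : _ \o _ = (fun z => (expR (t * z))%:E + (expR (- t * z))%:E))%E//.
  by apply: integrableD => //; exact: iexp.
have Ecosh (t : R) : \int[gam]_z (expR (t * z) + expR (- t * z)) = 2 * expR (t ^+ 2 / 2).
  rewrite (RintegralD _ (iexp t) (iexp (- t)))//.
  rewrite Rintegral_gauss_expR Rintegral_gauss_expR sqrrN; lra.
have E2 (t : R) : \int[gam]_z (2 + t * z ^+ 2) = 2 + t * V.
  rewrite (RintegralD _ (icst 2) (it2 t))//.
  by rewrite Rintegral_gauss_cst RintegralZl.
apply/eqP; rewrite eq_le; apply/andP; split.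
  apply/ler_addgt0Pl => e e0.
  pose t := Num.min e 1.
  have t0 : 0 < t by rewrite lt_min e0 ltr01.
  have t1 : t <= 1 by rewrite ge_min lexx orbT.
  have te : t <= e by rewrite ge_min lexx.
  (* Upper bound on [V]: this reads [2 + t ^+ 2 * V <= 2 * expR (t ^+ 2 / 2)], whose right-hand side
     is 2 plus [t ^+ 2] up to higher order. *)
  have : \int[gam]_z (2 + t ^+ 2 * z ^+ 2) <= \int[gam]_z (expR (t * z) + expR (- t * z)).
    apply: (le_Rintegral _ (it2' (t ^+ 2)) (icosh t)) => //.
    by move=> z _; rewrite -exprMn mulNr; exact: coshm1_ge.
  rewrite Ecosh E2 => H.
  have H2 : expR (t ^+ 2 / 2) <= (1 - t ^+ 2 / 2)^-1 by apply: expR_le_inv; nra.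
  have H3 : t ^+ 2 * V <= 2 * ((1 - t ^+ 2 / 2)^-1 - 1) by lra.
  have E : 2 * ((1 - t ^+ 2 / 2)^-1 - 1) = t ^+ 2 * (1 - t ^+ 2 / 2)^-1.
    by field; rewrite gt_eqF//; nra.
  rewrite E ler_pM2l ?exprn_gt0// in H3.
  apply: (le_trans H3).
  have t2 : t ^+ 2 <= t by rewrite expr2 ler_piMl// ltW.
  have t2e : t ^+ 2 * e <= e by rewrite ler_piMl//; [exact: ltW|lra].
  rewrite -[leRHS]invrK lef_pV2 ?posrE ?invr_gt0; [|nra|lra].
  rewrite -[leLHS]mul1r ler_pdivrMr; last by lra.
  have -> : (1 - t ^+ 2 / 2) * (e + 1) = 1 + e - t ^+ 2 / 2 - (t ^+ 2 * e) / 2 by lra.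
  lra.
(* Lower bound on [V]: [512 = 2 * 4 ^+ 4] combines the constants of [coshm1_le] and of
   [exprn_le_expR] at [k = 4]; the other factor is the integral of
   [expR (2 * z) + expR (- 2 * z)]. *)
pose C := 512 * (2 * expR (2 ^+ 2 / 2)) : R.
have C0 : 0 < C by rewrite /C; have := expR_gt0 (2 ^+ 2 / 2 : R); lra.
have key (t : R) : 0 < t -> t <= 1 -> 1 <= V + C * t.
  move=> t0 t1.
  have H z : expR (t * z) + expR (- t * z) <=
      2 + t ^+ 2 * z ^+ 2 + 512 * t ^+ 4 * (expR (2 * z) + expR (- 2 * z)).
    have := coshm1_le (t * z); rewrite -mulNr exprMn.
    suff : 2 * expR `|t * z| * `|t * z| ^+ 4 <=
      512 * t ^+ 4 * (expR (2 * z) + expR (- 2 * z)) by lra.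
    rewrite normrM (gtr0_norm t0) exprMn.
    have : expR (t * `|z|) <= expR `|z| by rewrite ler_expR ler_piMl.
    have := exprn_le_expR z 4.
    have : expR `|z| * expR `|z| <= expR (2 * z) + expR (- 2 * z).
      rewrite -expRD (_ : _ + _ = `|2 * z|); last by rewrite normrM ger0_norm//; lra.
      by rewrite mulNr; exact: expR_norm_le.
    set X := expR `|z|; set Y := _ + _; set W := expR (t * `|z|) => H1 H2 H3.
    have X0 : 0 <= X by exact: expR_ge0.
    have W0 : 0 <= W by exact: expR_ge0.
    have t4 : 0 <= t ^+ 4 by rewrite exprn_ge0// ltW.
    have : W * `|z| ^+ 4 <= 256 * Y.
      apply: (@le_trans _ _ (X * (4 ^+ 4 * X))); first by rewrite ler_pM// exprn_ge0.
      by rewrite mulrCA; lra.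
    move=> H4; have := ler_wpM2l t4 H4; lra.
  have I4 : gam.-integrable setT
      (EFin \o (fun z : R => 512 * t ^+ 4 * (expR (2 * z) + expR (- 2 * z)))).
    rewrite (_ : _ \o _ =
      (fun z => (512 * t ^+ 4)%:E * (expR (2 * z) + expR (- 2 * z))%:E))%E//.
    by apply: integrableZl => //; exact: icosh.
  have : \int[gam]_z (expR (t * z) + expR (- t * z)) <=
     \int[gam]_z ((2 + t ^+ 2 * z ^+ 2) + 512 * t ^+ 4 * (expR (2 * z) + expR (- 2 * z))).
    apply: (le_Rintegral _ (icosh t)) => //.
    rewrite (_ : _ \o _ = (fun z => (2 + t ^+ 2 * z ^+ 2)%:E +
      (512 * t ^+ 4 * (expR (2 * z) + expR (- 2 * z)))%:E))%E//.
    by apply: integrableD => //; exact: (it2' (t ^+ 2)).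
  rewrite (RintegralD _ (it2' (t ^+ 2)) I4)// (RintegralZl _ _ (icosh 2))//.
  rewrite !Ecosh E2 => H1.
  have H2 := expR_ge1Dx (t ^+ 2 / 2).
  have t2 : 0 < t ^+ 2 by rewrite exprn_gt0.
  rewrite -(ler_pM2l t2) mulr1.
  have E4 : t ^+ 4 = t ^+ 2 * t ^+ 2 by rewrite -exprD.
  have H3 : t ^+ 2 <= t ^+ 2 * V + t ^+ 2 * (C * t ^+ 2).
    have -> : t ^+ 2 * (C * t ^+ 2) = 512 * t ^+ 4 * (2 * expR (2 ^+ 2 / 2)) by rewrite E4 /C; ring.
    lra.
  rewrite (le_trans H3)// mulrDr lerD2l ler_pM2l// ler_pM2l//.
  by rewrite expr2 ler_piMl//; exact: ltW.
apply/ler_addgt0Pr => e e0.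
pose t := Num.min (e / C) 1.
have t0 : 0 < t by rewrite lt_min divr_gt0// ltr01.
have t1 : t <= 1 by rewrite ge_min lexx orbT.
have te : t <= e / C by rewrite ge_min lexx.
rewrite (le_trans (key t t0 t1))// lerD2l mulrC -ler_pdivlMr//.
Qed.

End gauss_moments.

(** * Partial sums of independent variables *)

Section joint_law.
Context {R : realType} {d : measure_display} {T : measurableType d}.
Variables (P : probability T R) (S Y : {RV P >-> R}).

Let SY (w : T) : (R * R)%type := (S w, Y w).

Let mSY : measurable_fun setT SY.
Proof.
by apply: measurable_fun_pair;
  [exact: (@measurable_funPT _ _ _ _ S)|exact: (@measurable_funPT _ _ _ _ Y)].
Qed.

(** Rectangles determine the joint law of [S] and [Y] restricted to [A]: it is the product of the
    marginals with one of them scaled by [P A]. The event [A] will carry the constraints on later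
    variables; [A = setT] gives the plain joint law. *)
Lemma joint_law_restr (A : set T) (mA : measurable A) :
  (forall C B : set R, measurable C -> measurable B ->
    P (S @^-1` C `&` (Y @^-1` B `&` A)) =
    (P (S @^-1` C) * P (Y @^-1` B) * P A)%E) ->
  forall X : set (R * R)%type, measurable X ->
    P ((fun w => (S w, Y w)) @^-1` X `&` A) =
    ((distribution P S \x distribution P Y) X * P A)%E.
Proof.
move=> H X mX.
have PAfin : P A \is a fin_num by exact: fin_num_measure.
pose c := NngNum (fine_ge0 (measure_ge0 P A)).
have := @product_measure_unique _ _ R R R (distribution P S)
  (mscale c (distribution P Y)) (pushforward (mrestr P mA) SY).
move=> /(_ mSY _ X mX) /= E; rewrite -[LHS]E; last first.
  move=> C B mC mB; rewrite /= /pushforward /mrestr /mscale /=.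
  rewrite fineK// [RHS]muleCA [RHS]muleC -H//.
  by congr (P _); apply/seteqP; split => w /=; rewrite /SY/=; tauto.
rewrite /= /product_measure1/= /mscale/=.
rewrite ge0_integralZl//=; first by rewrite fineK// muleC.
- by apply: measurable_fun_xsection.
- by rewrite lee_fin fine_ge0.
Qed.

Lemma ge0_expectation_joint (f : R * R -> \bar R) :
  (forall C B : set R, measurable C -> measurable B ->
    P (S @^-1` C `&` Y @^-1` B) = (P (S @^-1` C) * P (Y @^-1` B))%E) ->
  measurable_fun setT f -> (forall x, 0 <= f x)%E ->
  (\int[P]_w f (S w, Y w) = \int[P]_w \int[P]_v f (S w, Y v))%E.
Proof.
move=> H mf f0.
transitivity (\int[pushforward P SY]_z f z)%E.
  by rewrite ge0_integral_pushforward.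
transitivity (\int[distribution P S \x distribution P Y]_z f z)%E.
  apply: eq_measure_integral => X mX _.
  have := @joint_law_restr setT measurableT _ X mX.
  rewrite setIT probability_setT mule1; apply => C B mC mB.
  by rewrite setIT mule1 H.
rewrite fubini_tonelli1//= /fubini_F.
rewrite ge0_integral_distribution//; last 2 first.
- by apply: measurable_fun_fubini_tonelli_F.
- by move=> y; apply: integral_ge0.
apply: eq_integral => w _ /=.
rewrite ge0_integral_distribution//.
exact: measurable_fun_pair2.
Qed.

End joint_law.

Section partial_sums.
Context {R : realType} {d : measure_display} {T : measurableType d}.
Variables (P : probability T R) (Y : nat -> {RV P >-> R}).

Definition psum (m : nat) (w : T) : R := \sum_(j < m) Y j w.

Let measurable_psum m : measurable_fun setT (psum m).
Proof. by apply: measurable_sum => j; exact: measurable_funPT. Qed.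

HB.instance Definition _ m := isMeasurableFun.Build _ _ _ _ (psum m) (measurable_psum m).

Lemma psumS m w : psum m.+1 w = psum m w + Y m w.
Proof. by rewrite /psum big_ord_recr. Qed.

Hypothesis Yind : mutually_independent P Y.

(* The side events [Y j \in B j] for [m <= j], kept for an arbitrary finite [J],
   make the statement strong enough to be proved by induction on [m]. *)
Lemma psum_indep_capset (m : nat) (C : set R) (J : {fset nat}) (B : nat -> set R) :
  measurable C -> (forall j, measurable (B j)) ->
  (forall j, j \in J -> (m <= j)%N) ->
  P (psum m @^-1` C `&` \bigcap_(j in [set` J]) (Y j @^-1` B j)) =
  (P (psum m @^-1` C) * P (\bigcap_(j in [set` J]) (Y j @^-1` B j)))%E.
Proof.
move=> mC mB.
have mY j D : measurable D -> measurable (Y j @^-1` D).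
  by move=> mD; exact: measurable_funPTI.
have mbig (K : {fset nat}) : measurable (\bigcap_(j in [set` K]) (Y j @^-1` B j)).
  by apply: fin_bigcap_measurable => // j _; exact: mY.
elim: m C J B mC mB mbig => [|m IH] C J B mC mB mbig mJ.
  have psum0 : psum 0 = cst 0 by apply/funext => w; rewrite /psum big_ord0.
  rewrite psum0 preimage_cst; case: ifPn => _.
    by rewrite setTI probability_setT mul1e.
  by rewrite set0I measure0 mul0e.
set A := \bigcap_(j in _) _.
pose X : set (R * R)%type := [set z | C (z.1 + z.2)].
have mX : measurable X.
  rewrite -[X]setTI; apply: (_ : measurable_fun setT (fun z : R * R => z.1 + z.2)) => //.
  by apply: measurable_funD; [exact: measurable_fst|exact: measurable_snd].
have E1 : psum m.+1 @^-1` C = (fun w => (psum m w, Y m w)) @^-1` X.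
  by apply/seteqP; split => w; rewrite /X/= psumS.
have mJm : m \notin J by apply/negP => /mJ; rewrite ltnn.
have ind (K : {fset nat}) D : measurable D -> m \notin K ->
    (\bigcap_(j in [set` (m |` K)%fset]) (Y j @^-1` (if j == m then D else B j))) =
    Y m @^-1` D `&` \bigcap_(j in [set` K]) (Y j @^-1` B j).
  move=> mD mK; apply/seteqP; split=> w /=.
    move=> H; split.
      by have := H m; rewrite /= eqxx; apply; rewrite in_fset1U eqxx.
    move=> j jK; have := H j; rewrite /= in_fset1U jK orbT => /(_ isT).
    by case: eqP => // jm; move: mK; rewrite -jm jK.
  move=> [H1 H2] j /=; rewrite in_fset1U; case: eqP => [-> _//|_ /=]; exact: H2.
(* The event on [Y m] is counted among the side events, so the induction hypothesis at [m] splits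
   off [psum m] and mutual independence splits the rest. *)
have joint (K : {fset nat}) D : measurable D -> (forall j, j \in K -> (m < j)%N) ->
    forall C, measurable C ->
    P (psum m @^-1` C `&` (Y m @^-1` D `&` \bigcap_(j in [set` K]) (Y j @^-1` B j))) =
    (P (psum m @^-1` C) * P (Y m @^-1` D) * P (\bigcap_(j in [set` K]) (Y j @^-1` B j)))%E.
  move=> mD hK C' mC'.
  have mK : m \notin K by apply/negP => /hK; rewrite ltnn.
  rewrite -ind// IH//; last 3 first.
  - by move=> j; case: ifP.
  - by move=> K'; apply: fin_bigcap_measurable => // j _; apply: mY; case: ifP.
  - by move=> j; rewrite in_fset1U => /orP[/eqP->//|/hK/ltnW].
  rewrite -muleA; congr (_ * _)%E.
  rewrite Yind; last by move=> j _; case: ifP.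
  rewrite Yind// big_fsetU1//= eqxx; congr (_ * _)%E.
  rewrite big_seq [RHS]big_seq; apply: eq_bigr => j jK.
  by case: eqP => // jm; move: mK; rewrite -jm jK.
rewrite E1 (joint_law_restr (mbig J)) //; last first.
  by move=> C' D mC' mD; exact: joint.
congr (_ * _)%E.
(* The same law without side event identifies the remaining factor as the probability that
   [psum m.+1] lies in [C]. *)
have := @joint_law_restr _ _ _ P (psum m) (Y m) setT measurableT _ X mX.
rewrite setIT probability_setT mule1 => ->// C' D mC' mD.
have := joint fset0 D mD _ C' mC'.
rewrite set_fset0 bigcap_set0 probability_setT => ->//.
Qed.

Lemma psum_indep m (C B : set R) : measurable C -> measurable B ->
  P (psum m @^-1` C `&` Y m @^-1` B) = (P (psum m @^-1` C) * P (Y m @^-1` B))%E.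
Proof.
move=> mC mB.
have := @psum_indep_capset m C [fset m]%fset (fun=> B) mC (fun=> mB).
rewrite set_fset1 bigcap_set1 => ->// j.
by rewrite in_fset1 => /eqP->.
Qed.

Lemma ge0_expectation_psumS m (f : R * R -> \bar R) :
  measurable_fun setT f -> (forall x, 0 <= f x)%E ->
  (\int[P]_w f (psum m w, Y m w) = \int[P]_w \int[P]_v f (psum m w, Y m v))%E.
Proof.
move=> mf f0; apply: (@ge0_expectation_joint _ _ _ P (psum m) (Y m)) => //.
exact: psum_indep.
Qed.

End partial_sums.

(** * Lindeberg replacement *)

Section real_integrable.
Context {R : realType} {d : measure_display} {T : measurableType d}.
Variable P : probability T R.
Implicit Types f g : T -> R.

Lemma integrable_EFinD f g : P.-integrable setT (EFin \o f) ->
  P.-integrable setT (EFin \o g) -> P.-integrable setT (EFin \o (fun x => f x + g x)).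
Proof.
move=> fi gi; rewrite (_ : _ \o _ = (fun x => (f x)%:E + (g x)%:E))%E//.
exact: integrableD.
Qed.

Lemma integrable_EFinZl (k : R) f : P.-integrable setT (EFin \o f) ->
  P.-integrable setT (EFin \o (fun x => k * f x)).
Proof.
move=> fi; rewrite (_ : _ \o _ = (fun x => k%:E * (f x)%:E))%E//.
exact: integrableZl.
Qed.

Lemma integrable_EFin_cst (k : R) : P.-integrable setT (EFin \o (fun=> k)).
Proof. exact: finite_measure_integrable_cst. Qed.

Lemma integrable_EFin_bounded f (M : R) : measurable_fun setT f ->
  (forall x, `|f x| <= M) -> P.-integrable setT (EFin \o f).
Proof.
move=> mf B; apply: le_integrable (integrable_EFin_cst M) => //.
  exact/measurable_EFinP.
by move=> x _; rewrite lee_fin (le_trans (B x))// ler_norm.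
Qed.

Lemma ge0_le_integralD_cst (f g : T -> \bar R) (e : R) : 0 <= e ->
  measurable_fun setT f -> measurable_fun setT g ->
  (forall x, 0 <= f x)%E -> (forall x, 0 <= g x)%E ->
  (forall x, f x <= g x + e%:E)%E ->
  (\int[P]_x f x <= \int[P]_x g x + e%:E)%E.
Proof.
move=> e0 mf mg f0 g0 H.
rewrite (_ : e%:E = \int[P]_x (cst e%:E x))%E; last first.
  rewrite integral_cst// [X in (_ * X)%E](_ : _ = 1%E) ?mule1//.
  exact: probability_setT.
rewrite -ge0_integralD//.
apply: ge0_le_integral => //; exact: emeasurable_funD.
Qed.

(** The first-order term integrates to 0, so the approximating value sees the law of [Y] only
    through its variance; two laws sharing it are compared via this common value. *)
Lemma taylor_expectation (f : R -> R) (x a1 a2 C p : R) (Y : T -> R) :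
  measurable_fun setT f -> (forall y, `|f y| <= 1) ->
  measurable_fun setT Y ->
  P.-integrable setT (EFin \o Y) ->
  P.-integrable setT (EFin \o (fun w => Y w ^+ 2)) ->
  P.-integrable setT (EFin \o (fun w => `|Y w| `^ p)) ->
  \int[P]_w Y w = 0 ->
  (forall t, `|f (x + t) - f x - t * a1 - t ^+ 2 / 2 * a2| <= C * `|t| `^ p) ->
  `|\int[P]_w f (x + Y w) - (f x + a2 / 2 * \int[P]_w (Y w ^+ 2))| <=
    C * \int[P]_w (`|Y w| `^ p).
Proof.
move=> mf f1 mY iY iY2 iYp EY H.
have ifY : P.-integrable setT (EFin \o (fun w => f (x + Y w))).
  apply: (@integrable_EFin_bounded _ 1) => //.
  by apply: (measurableT_comp mf); apply: measurable_funD.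
have iq : P.-integrable setT (EFin \o (fun w => f x + (a1 * Y w + a2 / 2 * Y w ^+ 2))).
  apply: integrable_EFinD; first exact: integrable_EFin_cst.
  by apply: integrable_EFinD; exact: integrable_EFinZl.
have Eq : \int[P]_w (f x + (a1 * Y w + a2 / 2 * Y w ^+ 2)) =
    f x + a2 / 2 * \int[P]_w (Y w ^+ 2).
  rewrite RintegralD//; last 2 first.
  - exact: integrable_EFin_cst.
  - by apply: integrable_EFinD; exact: integrable_EFinZl.
  rewrite (Rintegral_cst_prob P) RintegralD//; last 2 first.
  - exact: integrable_EFinZl.
  - exact: integrable_EFinZl.
  by rewrite !RintegralZl// EY mulr0 add0r.
rewrite -Eq -RintegralB//.
apply: (le_trans (le_normr_Rintegral _ _)) => //.
  rewrite (_ : _ \o _ = (fun w => (f (x + Y w))%:E -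
    (f x + (a1 * Y w + a2 / 2 * Y w ^+ 2))%:E))%E//.
  exact: integrableB.
rewrite -RintegralZl//; apply: le_Rintegral => //.
- apply: (@integrable_norm _ _ _ P setT
    (fun w => f (x + Y w) - (f x + (a1 * Y w + a2 / 2 * Y w ^+ 2)))).
  rewrite (_ : _ \o _ = (fun w => (f (x + Y w))%:E -
    (f x + (a1 * Y w + a2 / 2 * Y w ^+ 2))%:E))%E//.
  exact: integrableB.
- exact: integrable_EFinZl.
- move=> w _; apply: le_trans (H (Y w)); rewrite le_eqVlt; apply/orP; left.
  by apply/eqP; congr `|_|; lra.
Qed.

End real_integrable.

Lemma le_telescope {R : realType} (u : nat -> \bar R) (e : R) N :
  (forall m, (m < N)%N -> (u m.+1 <= u m + e%:E)%E /\ (u m <= u m.+1 + e%:E)%E) ->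
  (u N <= u 0%N + (N%:R * e)%:E /\ u 0%N <= u N + (N%:R * e)%:E)%E.
Proof.
elim: N => [|N IH] H; first by rewrite mul0r adde0.
have [m mN|IH1 IH2] := IH; first by apply: H; exact: ltnW.
have [h1 h2] := H N (ltnSn N).
rewrite -natr1 mulrDl mul1r EFinD; split.
  by rewrite addeA (le_trans h1)// leeD2r.
by rewrite [X in (_ + X)%E]addeC addeA (le_trans IH2)// leeD2r.
Qed.

Section lindeberg.
Context {R : realType} {d : measure_display} {T : measurableType d}.
Variables (P : probability T R) (Y : nat -> {RV P >-> R}).
Hypothesis Yind : mutually_independent P Y.
Variables (N : nat) (p L : R).
Hypothesis N0 : (0 < N)%N.
Hypothesis p23 : 2 <= p <= 3.
Hypothesis Y1 : forall j, P.-integrable setT (EFin \o Y j).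
Hypothesis Y2 : forall j, P.-integrable setT (EFin \o (fun w => Y j w ^+ 2)).
Hypothesis Yp : forall j, P.-integrable setT (EFin \o (fun w => `|Y j w| `^ p)).
Hypothesis EY1 : forall j, \int[P]_w Y j w = 0.
Hypothesis EY2 : forall j, \int[P]_w (Y j w ^+ 2) = N%:R^-1.
Hypothesis EYp : forall j, \int[P]_w (`|Y j w| `^ p) <= L.

Variables (f f1 f2 : R -> R) (C : R).
Hypothesis cf : continuous f.
Hypothesis f01 : forall x, 0 <= f x <= 1.
Hypothesis C0 : 0 <= C.
Hypothesis fT : forall q x t, 2 <= q <= 3 ->
  `|f (x + t) - f x - t * f1 x - t ^+ 2 / 2 * f2 x| <= C * `|t| `^ q.

Local Notation gam := (@normal_prob R 0 1).

Let s : R := Num.sqrt N%:R^-1.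
(** Standard deviation of the sum of [N - m] independent N(0,1/N) variables, which are kept merged
    into one. *)
Let c (m : nat) : R := Num.sqrt ((N - m)%:R / N%:R).
Let K : R := \int[gam]_z (`|z| ^+ 3).
Let eps : R := C * (L + s ^+ 3 * K).

Let f0 x : 0 <= f x. Proof. by case/andP: (f01 x). Qed.
Let fn x : `|f x| <= 1. Proof. by rewrite ger0_norm//; case/andP: (f01 x). Qed.
Let mf : measurable_fun setT f. Proof. exact: continuous_measurable_fun. Qed.

Let s0 : 0 < s. Proof. by rewrite sqrtr_gt0 invr_gt0 ltr0n. Qed.
Let s2 : s ^+ 2 = N%:R^-1. Proof. by rewrite sqr_sqrtr// invr_ge0 ler0n. Qed.

Let A m x : R := \int[P]_w f (x + Y m w).
Let B x : R := \int[gam]_z f (x + s * z).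

Let ifY m x : P.-integrable setT (EFin \o (fun w => f (x + Y m w))).
Proof.
apply: (@integrable_EFin_bounded _ _ _ _ _ 1) => //.
by apply: (measurableT_comp mf); apply: measurable_funD => //.
Qed.

Let ifg x a : gam.-integrable setT (EFin \o (fun z => f (x + a * z))).
Proof.
apply: (@integrable_EFin_bounded _ _ _ gam _ 1) => //.
apply: (measurableT_comp mf); apply: measurable_funD => //.
Qed.

Let AE m x : (\int[P]_w (f (x + Y m w))%:E)%E = (A m x)%:E.
Proof. by rewrite /A /Rintegral fineK//; exact: integrable_fin_num (ifY m x). Qed.

Let BE x : (\int[gam]_z (f (x + s * z))%:E)%E = (B x)%:E.
Proof. by rewrite /B /Rintegral fineK//; exact: integrable_fin_num (ifg x s). Qed.

Let A_ge0 m x : 0 <= A m x.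
Proof. by apply: Rintegral_ge0. Qed.

Let B_ge0 x : 0 <= B x.
Proof. by apply: Rintegral_ge0. Qed.

Let K0 : 0 <= K.
Proof. by apply: Rintegral_ge0 => z _; rewrite exprn_ge0. Qed.

Let L0 : 0 <= L.
Proof. by apply: le_trans (EYp 0); apply: Rintegral_ge0 => z _; rewrite powR_ge0. Qed.

Let eps0 : 0 <= eps.
Proof. by rewrite mulr_ge0// addr_ge0// mulr_ge0// exprn_ge0// ltW. Qed.

Let AB m x : `|A m x - B x| <= eps.
Proof.
pose M := f x + f2 x / 2 * N%:R^-1.
have HA : `|A m x - M| <= C * L.
  rewrite /M -(EY2 m); apply: le_trans (ler_wpM2l C0 (EYp m)).
  apply: (@taylor_expectation _ _ _ P f x (f1 x) (f2 x) C p (Y m)) => //.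
  by move=> t; exact: fT.
(* The Gaussian is always treated with exponent 3, whatever [p] is: the total over [N] replacements
   is then of order [N ^ (-1/2)]. *)
have HB : `|B x - M| <= C * (s ^+ 3 * K).
  have i2 := integrable_EFinZl (N%:R^-1)
    (integrable_gauss_exprn 2 : (gam : probability _ R).-integrable _ _).
  have i3 := integrable_EFinZl (s ^+ 3)
    (integrable_gauss_norm_exprn 3 : (gam : probability _ R).-integrable _ _).
  have E2 : (fun z : R => (s * z) ^+ 2) = (fun z => s ^+ 2 * z ^+ 2).
    by apply/funext => z; rewrite exprMn.
  have E3 : (fun z : R => `|s * z| `^ 3) = (fun z => s ^+ 3 * `|z| ^+ 3).
    by apply/funext => z; rewrite powR_mulrn// normrM exprMn gtr0_norm.
  have := @taylor_expectation _ _ _ gam f x (f1 x) (f2 x) C 3 (fun z => s * z).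
  rewrite E2 E3 RintegralZl//; last exact: (integrable_gauss_exprn 1).
  rewrite RintegralZl//; last exact: integrable_gauss_exprn.
  rewrite RintegralZl//; last exact: integrable_gauss_norm_exprn.
  rewrite gauss_mean gauss_var mulr1 mulr0 s2; apply => //.
  - exact: mulrl_measurable.
  - exact: integrable_EFinZl (integrable_gauss_exprn 1).
  - by move=> t; apply: fT; apply/andP; split; lra.
rewrite /eps mulrDr.
have -> : A m x - B x = (A m x - M) - (B x - M) by lra.
by rewrite (le_trans (ler_normB _ _))// lerD.
Qed.

(* The sum after the last [N - m] terms have been replaced by Gaussians. *)
Let H m : \bar R := (\int[P]_w \int[gam]_z (f (psum Y m w + c m * z))%:E)%E.

(** The term [Y m] is decoupled from [psum Y m] by independence and integrated innermost by Tonelli,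
    so that the comparison with [HB] reduces to [A m] against [B]. *)
Let HA m : (m < N)%N ->
  H m.+1 = (\int[P]_w \int[gam]_z (A m (psum Y m w + c m.+1 * z))%:E)%E.
Proof.
move=> mN; rewrite /H.
pose F (sy : R * R) := (\int[gam]_z (f (sy.1 + sy.2 + c m.+1 * z))%:E)%E.
have mF : measurable_fun setT F.
  apply: (@measurable_fun_fubini_tonelli_F _ _ (R * R)%type _ _ gam
    (fun q => (f (q.1.1 + q.1.2 + c m.+1 * q.2))%:E)); last by move=> q; rewrite lee_fin.
  apply/measurable_EFinP; apply: (measurableT_comp mf).
  apply: measurable_funD.
    by apply: measurable_funD; [exact: (measurableT_comp measurable_fst measurable_fst)|
      exact: (measurableT_comp measurable_snd measurable_fst)].
  by apply: measurable_funM; [exact: measurable_cst|exact: measurable_snd].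
transitivity (\int[P]_w F (psum Y m w, Y m w))%E.
  by apply: eq_integral => w _; rewrite /F/=; under eq_integral do rewrite psumS.
rewrite (ge0_expectation_psumS Yind m mF); last first.
  by move=> q; apply: integral_ge0 => z _; rewrite lee_fin.
apply: eq_integral => w _; rewrite /F/=.
rewrite (@fubini_tonelli _ _ T (measurableTypeR R) R P gam
  (fun q => (f (psum Y m w + Y m q.1 + c m.+1 * q.2))%:E)); last 2 first.
- apply/measurable_EFinP; apply: (measurableT_comp mf).
  apply: measurable_funD.
    by apply: measurable_funD; [exact: measurable_cst|
      exact: (measurableT_comp (@measurable_funPT _ _ _ _ (Y m)) measurable_fst)].
  by apply: measurable_funM; [exact: measurable_cst|exact: measurable_snd].
- by move=> q; rewrite lee_fin.
apply: eq_integral => z _; rewrite -AE; apply: eq_integral => v _ /=.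
by rewrite addrAC.
Qed.

(** One N(0,1/N) variable is split off the Gaussian part, since [c m ^+ 2 = c m.+1 ^+ 2 + N^-1]. *)
Let HB m : (m < N)%N ->
  H m = (\int[P]_w \int[gam]_z (B (psum Y m w + c m.+1 * z))%:E)%E.
Proof.
move=> mN; apply: eq_integral => w _.
have -> : c m = Num.sqrt (c m.+1 ^+ 2 + s ^+ 2).
  congr Num.sqrt; rewrite s2 sqr_sqrtr ?divr_ge0 ?ler0n//.
  by rewrite -(subnSK mN) -natr1 mulrDl mul1r.
rewrite -(gauss_rotation _ _ s0 cf)//.
by apply: eq_integral => y _; rewrite -BE.
Qed.

Let HS m : (m < N)%N -> (H m.+1 <= H m + eps%:E)%E /\ (H m <= H m.+1 + eps%:E)%E.
Proof.
move=> mN; rewrite HA// HB//.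
have mA : measurable_fun setT (A m).
  rewrite (_ : A m = fine \o (fun x => \int[P]_w (f (x + Y m w))%:E))%E//.
  apply: measurableT_comp => //.
  apply: (@measurable_fun_fubini_tonelli_F _ _ R T _ P
    (fun q => (f (q.1 + Y m q.2))%:E)); last first.
    by move=> q; rewrite lee_fin.
  apply/measurable_EFinP; apply: (measurableT_comp mf).
  apply: measurable_funD; first exact: measurable_fst.
  exact: (measurableT_comp (@measurable_funPT _ _ _ _ (Y m)) measurable_snd).
have mB : measurable_fun setT B.
  rewrite (_ : B = fine \o (fun x => \int[gam]_w (f (x + s * w))%:E))%E//.
  apply: measurableT_comp => //.
  apply: (@measurable_fun_fubini_tonelli_F _ _ R (measurableTypeR R) _ gam
    (fun q => (f (q.1 + s * q.2))%:E)); last first.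
    by move=> q; rewrite lee_fin.
  apply/measurable_EFinP; apply: (measurableT_comp mf).
  apply: measurable_funD; first exact: measurable_fst.
  by apply: measurable_funM; [exact: measurable_cst|exact: measurable_snd].
have mw (g : R -> R) : measurable_fun setT g ->
    measurable_fun setT
      (fun q : T * measurableTypeR R => (g (psum Y m q.1 + c m.+1 * q.2))%:E).
  move=> mg; apply/measurable_EFinP; apply: (measurableT_comp mg); apply: measurable_funD.
    exact: (measurableT_comp (@measurable_funPT _ _ _ _ (psum Y m)) measurable_fst).
  by apply: measurable_funM; [exact: measurable_cst|exact: measurable_snd].
have mI (g : R -> R) : measurable_fun setT g -> (forall x, 0 <= g x) ->
    measurable_fun setT (fun w => \int[gam]_z (g (psum Y m w + c m.+1 * z))%:E)%E.
  move=> mg g0.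
  apply: (@measurable_fun_fubini_tonelli_F _ _ T (measurableTypeR R) _ gam
    (fun q => (g (psum Y m q.1 + c m.+1 * q.2))%:E)) => //; first exact: mw.
  by move=> q; rewrite lee_fin.
have key (g h : R -> R) : measurable_fun setT g -> measurable_fun setT h ->
    (forall x, 0 <= g x) -> (forall x, 0 <= h x) -> (forall x, g x <= h x + eps) ->
    (\int[P]_w \int[gam]_z (g (psum Y m w + c m.+1 * z))%:E <=
     \int[P]_w \int[gam]_z (h (psum Y m w + c m.+1 * z))%:E + eps%:E)%E.
  move=> mg mh g0 h0 gh.
  have m2 (k : R -> R) w : measurable_fun setT k ->
      measurable_fun setT (fun z : measurableTypeR R => (k (psum Y m w + c m.+1 * z))%:E).
    move=> mk; apply/measurable_EFinP; apply: (measurableT_comp mk).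
    by apply: measurable_funD.
  apply: (@ge0_le_integralD_cst _ _ _ P) => //; [exact: mI|exact: mI| | |].
  - by move=> w; apply: integral_ge0 => z _; rewrite lee_fin.
  - by move=> w; apply: integral_ge0 => z _; rewrite lee_fin.
  move=> w; apply: (@ge0_le_integralD_cst _ _ _ gam) => //; [exact: m2|exact: m2|..].
  - by move=> z; rewrite lee_fin.
  - by move=> z; rewrite lee_fin.
  - by move=> z; rewrite -EFinD lee_fin.
split; apply: key => // x.
- by have := AB m x; rewrite ler_norml => /andP[_]; lra.
- by have := AB m x; rewrite ler_norml => /andP[+ _]; lra.
Qed.

Let H0E : H 0 = (\int[gam]_z (f z)%:E)%E.
Proof.
rewrite /H.
under eq_integral => w _.
  under eq_integral => z _
    do rewrite /psum big_ord0 add0r /c subn0 divff ?pnatr_eq0 -?lt0n// sqrtr1 mul1r.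
  over.
by rewrite integral_cst// [X in (_ * X)%E](_ : _ = 1%E) ?mule1//; exact: probability_setT.
Qed.

Let HNE : H N = (\int[P]_w (f (psum Y N w))%:E)%E.
Proof.
apply: eq_integral => w _.
under eq_integral => z _ do rewrite /c subnn mul0r sqrtr0 mul0r addr0.
by rewrite integral_cst// [X in (_ * X)%E](_ : _ = 1%E) ?mule1//; exact: probability_setT.
Qed.

Lemma lindeberg_bound :
  (\int[P]_w (f (psum Y N w))%:E <= \int[gam]_z (f z)%:E + (N%:R * eps)%:E /\
   \int[gam]_z (f z)%:E <= \int[P]_w (f (psum Y N w))%:E + (N%:R * eps)%:E)%E.
Proof.
by rewrite -H0E -HNE; exact: le_telescope HS.
Qed.

End lindeberg.

(** * Convergence in distribution from logistic test functions *)

Section logistic_indicator.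
Context {R : realType}.
Implicit Types lam c del eta a y : R.

(** The steepness is chosen so that [expR (- (lam * del)) = expR (- eta^-1)], which is at most [eta]
    because the exponential dominates the identity. *)
Lemma logistic_step lam c del eta y : 0 < del -> 0 < eta ->
  lam = (del * eta)^-1 ->
  (y <= c - del -> 1 - eta <= logistic lam c y) /\
  (c + del <= y -> logistic lam c y <= eta).
Proof.
move=> d0 e0 lE.
have l0 : 0 < lam by rewrite lE invr_gt0 mulr_gt0.
have ldE : lam * del = eta^-1 by rewrite lE invfM mulrAC mulVf ?mul1r ?gt_eqF.
have small : expR (- (lam * del)) <= eta.
  rewrite expRN ldE -[leRHS]invrK lef_pV2 ?posrE ?invr_gt0 ?expR_gt0//.
  by apply: le_trans (expR_ge1Dx _); rewrite lerDr.
split=> H; rewrite /logistic.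
  set u := expR _.
  have u0 : 0 < u by exact: expR_gt0.
  have ue : u <= eta.
    by apply: le_trans small; rewrite ler_expR -mulrN ler_pM2l//; lra.
  rewrite -[leRHS]mul1r ler_pdivlMr; last by lra.
  nra.
set u := expR _.
have u0 : 0 < u by exact: expR_gt0.
apply: le_trans small; rewrite -[leRHS]invrK lef_pV2 ?posrE ?invr_gt0 ?expR_gt0//; last by lra.
rewrite -expRN opprK (@le_trans _ _ u)//; last by lra.
by rewrite ler_expR ler_pM2l//; lra.
Qed.

Lemma continuous_logistic lam c : continuous (logistic lam c).
Proof.
move=> y; apply: differentiable_continuous; apply/derivable1_diffP.
by case: (@is_derive_logistic R lam c y).
Qed.

End logistic_indicator.

Section indicator_bounds.
Context {R : realType} {d : measure_display} {T : measurableType d}.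
Variables (P : probability T R) (X : T -> R).
Hypothesis mX : measurable_fun setT X.
Variables (f : R -> R) (a eta : R).
Hypothesis mf : measurable_fun setT f.
Hypothesis f0 : forall y, 0 <= f y.
Hypothesis eta0 : 0 <= eta.

Let mA : measurable (X @^-1` `]-oo, a]).
Proof. by rewrite -[X in measurable X]setTI; exact: mX. Qed.

Let mI : measurable_fun setT (fun w => (\1_(X @^-1` `]-oo, a]) w)%:E : \bar R).
Proof. by apply/measurable_EFinP; exact: measurable_indic. Qed.

Let mfX : measurable_fun setT (fun w => (f (X w))%:E).
Proof. by apply/measurable_EFinP; exact: (measurableT_comp mf). Qed.

Let indicX w : \1_(X @^-1` `]-oo, a]) w = ((X w <= a)%R)%:R :> R.
Proof. by rewrite indicE; congr (nat_of_bool _)%:R; apply/idP/idP; rewrite inE /= in_itv. Qed.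

Lemma prob_le_expectation :
  (forall y, y <= a -> 1 <= f y + eta) ->
  (P (X @^-1` `]-oo, a]) <= \int[P]_w (f (X w))%:E + eta%:E)%E.
Proof.
move=> H; rewrite -[X in P X]setIT -integral_indic//.
apply: ge0_le_integralD_cst => //.
  by move=> w; rewrite lee_fin.
move=> w; rewrite -EFinD lee_fin indicX; have [h|h] := leP (X w) a.
  by rewrite mulr1n H.
by rewrite mulr0n addr_ge0.
Qed.

Lemma expectation_le_prob :
  (forall y, f y <= 1 + eta) -> (forall y, a < y -> f y <= eta) ->
  (\int[P]_w (f (X w))%:E <= P (X @^-1` `]-oo, a]) + eta%:E)%E.
Proof.
move=> H1 H; rewrite -[X in P X]setIT -integral_indic//.
apply: ge0_le_integralD_cst => //.
  by move=> w; rewrite lee_fin.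
move=> w; rewrite -EFinD lee_fin indicX; have [h|h] := leP (X w) a.
  by rewrite mulr1n H1.
by rewrite mulr0n add0r H.
Qed.

End indicator_bounds.

Section cvg_in_distribution_logistic.
Context {R : realType} {d : nat -> measure_display}.
Variables (T : forall n, measurableType (d n)) (P : forall n, probability (T n) R).
Variables (X : forall n, {RV (P n) >-> R}) (mu : probability (measurableTypeR R) R).

Let close (lam c e : R) n :=
    (\int[P n]_w (logistic lam c (X n w))%:E <= \int[mu]_y (logistic lam c y)%:E + e%:E /\
     \int[mu]_y (logistic lam c y)%:E <= \int[P n]_w (logistic lam c (X n w))%:E + e%:E)%E.

Let F (t : R) := fine (mu `]-oo, t]%classic).
Let G n (t : R) := fine (cdf (X n : {RV (P n) >-> R}) t).

(** Centred at [x + del], the logistic is almost 1 up to [x] and almost 0 from [x + 2 * del] on; the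
    centre [x - del] serves the other bound. Each of the two indicator comparisons costs one [eta],
    and the closeness of the expectations a third. *)
Let cdf_close (x del eta : R) n : 0 < del -> 0 < eta ->
  close (del * eta)^-1 (x + del) eta n -> close (del * eta)^-1 (x - del) eta n ->
  G n x <= F (x + 2 * del) + 3 * eta /\ F (x - 2 * del) <= G n x + 3 * eta.
Proof.
move=> d0 eta0; rewrite /close; set lam := _^-1.
move=> [Up _] [_ Lo].
have mlog c : measurable_fun setT (@logistic R lam c).
  by apply: continuous_measurable_fun; exact: continuous_logistic.
have log0 c y : 0 <= @logistic R lam c y by rewrite ltW// logistic_gt0.
have log1 c y : @logistic R lam c y <= 1 + eta.
  by rewrite (le_trans (logistic_le1 _ _ _))// lerDl ltW.
have mXn : measurable_fun setT (X n) by exact: measurable_funPT.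
have midR : measurable_fun [set: measurableTypeR R] (idfun : measurableTypeR R -> R).
  exact: measurable_id.
have Ffin t : mu `]-oo, t]%classic \is a fin_num by exact: fin_num_measure.
have Cfin t : cdf (X n : {RV (P n) >-> R}) t \is a fin_num by exact: fin_num_measure.
split.
  have U1 := prob_le_expectation (P n) mXn (a := x) (mlog (x + del)) (log0 _) (ltW eta0).
  have U2 := expectation_le_prob mu midR (a := x + 2 * del) (mlog (x + del)) (log0 _) (ltW eta0).
  have : (cdf (X n : {RV (P n) >-> R}) x <=
      mu `]-oo, (x + 2 * del)%R]%classic + eta%:E + eta%:E + eta%:E)%E.
    apply: le_trans (U1 _) _ => [y yx|].
      have [+ _] := @logistic_step R lam (x + del) del eta y d0 eta0 erefl.
      by rewrite addrK => /(_ yx); lra.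
    apply: leeD2r; apply: le_trans Up _; apply: leeD2r; apply: U2 => // y yx.
    have [_ +] := @logistic_step R lam (x + del) del eta y d0 eta0 erefl.
    by apply; lra.
  rewrite -(fineK (Cfin x)) -(fineK (Ffin (x + 2 * del))) -!EFinD lee_fin /G /F; lra.
have U1 := prob_le_expectation mu midR (a := x - 2 * del) (mlog (x - del)) (log0 _) (ltW eta0).
have U2 := expectation_le_prob (P n) mXn (a := x) (mlog (x - del)) (log0 _) (ltW eta0).
have : (mu `]-oo, (x - 2 * del)%R]%classic <=
    cdf (X n : {RV (P n) >-> R}) x + eta%:E + eta%:E + eta%:E)%E.
  apply: le_trans (U1 _) _ => [y yx|].
    have [+ _] := @logistic_step R lam (x - del) del eta y d0 eta0 erefl.
    have -> : x - del - del = x - 2 * del by lra.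
    by move=> /(_ yx); lra.
  apply: leeD2r; apply: le_trans Lo _; apply: leeD2r; apply: U2 => // y yx.
  have [_ +] := @logistic_step R lam (x - del) del eta y d0 eta0 erefl.
  by apply; lra.
rewrite -(fineK (Cfin x)) -(fineK (Ffin (x - 2 * del))) -!EFinD lee_fin /G /F; lra.
Qed.

Lemma cvg_in_distribution_logistic :
  (forall (lam c e : R), 0 < e -> \forall n \near \oo,
    (\int[P n]_w (logistic lam c (X n w))%:E <= \int[mu]_y (logistic lam c y)%:E + e%:E /\
     \int[mu]_y (logistic lam c y)%:E <= \int[P n]_w (logistic lam c (X n w))%:E + e%:E)%E) ->
  cvg_in_distribution P X mu.
Proof.
move=> H x cx.
have Ffin t : mu `]-oo, t]%classic \is a fin_num by exact: fin_num_measure.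
rewrite -(fineK (Ffin x)).
apply/fine_cvgP; split; first by apply: nearW => n; exact: fin_num_measure.
apply/cvgrPdist_le => e e0.
(* The errors [3 * (e / 8)] from [cdf_close] and [e / 8] from the continuity of [F] at [x] add up to
   less than [e]. *)
have eta0 : 0 < e / 8 by rewrite divr_gt0.
have cF : F t @[t --> x] --> F x by apply: fine_cvg; rewrite fineK.
move/cvgrPdist_le : cF => /(_ _ eta0) [del0 /= d0 Hd].
pose del := del0 / 3.
have del_gt0 : 0 < del by rewrite divr_gt0.
have Fp : `|F x - F (x + 2 * del)| <= e / 8.
  by apply: Hd => /=; rewrite opprD addNKr normrN gtr0_norm ?mulr_gt0// /del; lra.
have Fm : `|F x - F (x - 2 * del)| <= e / 8.
  by apply: Hd => /=; rewrite opprB addrC subrK gtr0_norm ?mulr_gt0// /del; lra.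
have := H (del * (e / 8))^-1 (x + del) (e / 8) eta0.
have := H (del * (e / 8))^-1 (x - del) (e / 8) eta0.
apply: filterS2 => n c1 c2.
have [U L] := cdf_close del_gt0 eta0 c2 c1.
rewrite -/(F x) -/(G n x).
move: Fp Fm; rewrite !ler_norml => /andP[Fp1 Fp2] /andP[Fm1 Fm2].
by apply/andP; split; lra.
Qed.

End cvg_in_distribution_logistic.

(** * Mixtures of two Gaussians *)

(** Half-open intervals are differences of half-lines, which finiteness allows to subtract; they
    form a generating class stable under intersection and exhaust the line. *)
Lemma cdf_unique {R : realType} (m1 m2 : {measure set (measurableTypeR R) -> \bar R}) :
  (forall x : R, m1 `]-oo, x]%classic \is a fin_num) ->
  (forall x : R, m1 `]-oo, x]%classic = m2 `]-oo, x]%classic) ->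
  forall A, measurable A -> m1 A = m2 A.
Proof.
move=> fin E A mA.
have Eoc (a b : R) : m1 `]a, b]%classic = m2 `]a, b]%classic.
  have [ab|ba] := ltP a b; last first.
    by rewrite set_itv_ge ?measure0// bnd_simp -leNgt.
  have -> : `]a, b]%classic = `]-oo, b]%classic `\` `]-oo, a]%classic :> set (measurableTypeR R).
    by rewrite -[RHS]setCK setCD setCitvl setUC -[LHS]setCK setCitv.
  have sub : `]-oo, b]%classic `&` `]-oo, a]%classic = `]-oo, a]%classic :> set (measurableTypeR R).
    by rewrite setIidr//; apply: subset_itvl; rewrite bnd_simp ltW.
  have lty x : (m1 `]-oo, x]%classic < +oo)%E by rewrite -ge0_fin_numE.
  have lty2 x : (m2 `]-oo, x]%classic < +oo)%E by rewrite -E; exact: lty.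
  rewrite (measureD (mu := m1))//; last exact: lty.
  rewrite (measureD (mu := m2))//; last exact: lty2.
  by rewrite sub; congr (_ - _)%E; exact: E.
apply: (@measure_unique _ R (measurableTypeR R) (R.-ocitv.-measurable)
    (fun k => `](- k%:R : R), k%:R]%classic)) => //.
- by move=> B D mB mD; exact: measurableI.
- by move=> k; exact: is_ocitv.
- rewrite -subTset => x _; exists (Num.truncn `|x|).+1 => //=; rewrite in_itv/=.
  have := truncnS_gt `|x|; rewrite ltr_norml => /andP[-> /ltW ->//].
- by move=> _ [[a b] _ <-]; exact: Eoc.
- move=> k; apply: le_lt_trans (_ : m1 `]-oo, k%:R]%classic < +oo)%E.
    by apply: le_measure; rewrite ?inE//; apply: subset_itvr.
  by rewrite -ge0_fin_numE.
Qed.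

Section mixture.
Context {R : realType} {d : measure_display} {T : measurableType d}.
Variables (P : probability T R) (Z : {RV P >-> R}) (m sigma : R).
Hypothesis sigma_gt0 : 0 < sigma.
Local Notation gam := (@normal_prob R 0 1).

Hypothesis Z_law : forall x,
  cdf Z x = (Phi x / 2 + Phi ((x - m) / sigma) / 2)%:E.

Let aff (z : measurableTypeR R) : measurableTypeR R := m + sigma * z.

Let maff : measurable_fun setT aff.
Proof. by apply: measurable_funD; [exact: measurable_cst|exact: mulrl_measurable]. Qed.

Let half : {nonneg R} := (2^-1)%:nng.

(** The distribution function identifies the law of [Z] as half of [gam] plus half of its image
    under [aff]. *)
Lemma ge0_expectation_mixture (g : R -> \bar R) :
  measurable_fun setT g -> (forall x, 0 <= g x)%E ->
  (\int[P]_w g (Z w) =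
   2^-1%:E * (\int[gam]_z g z + \int[gam]_z g (m + sigma * z)%R))%E.
Proof.
move=> mg g0.
have mZ : measurable_fun setT (Z : T -> measurableTypeR R).
  exact: (@measurable_funPT _ _ _ _ Z).
pose Zm : {mfun T >-> measurableTypeR R} :=
  HB.pack (Z : T -> measurableTypeR R)
    (isMeasurableFun.Build _ _ _ _ (Z : T -> measurableTypeR R) mZ).
pose am : {mfun measurableTypeR R >-> measurableTypeR R} :=
  HB.pack aff (isMeasurableFun.Build _ _ _ _ aff maff).
pose nu1 : {measure set (measurableTypeR R) -> \bar R} := mscale half gam.
pose nu2 : {measure set (measurableTypeR R) -> \bar R} := mscale half (distribution gam am).
pose nu : {measure set (measurableTypeR R) -> \bar R} := measure_add nu1 nu2.
have law A : measurable A -> distribution P Zm A = nu A.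
  apply: cdf_unique => x; first by exact: fin_num_measure.
  transitivity (cdf Z x) => //; rewrite Z_law.
  have -> : nu `]-oo, x]%classic = (nu1 `]-oo, x]%classic + nu2 `]-oo, x]%classic)%E.
    exact: measure_addE.
  have gfin y : gam `]-oo, y]%classic \is a fin_num by exact: fin_num_measure.
  have -> : nu1 `]-oo, x]%classic = (2^-1 * Phi x)%:E.
    by rewrite EFinM /Phi fineK.
  have -> : nu2 `]-oo, x]%classic = (2^-1 * Phi ((x - m) / sigma))%:E.
    rewrite EFinM /Phi fineK//; congr (_ * gam _)%E.
    apply/seteqP; split => z /=; rewrite !in_itv/= /aff ler_pdivlMr//.
      by rewrite [z * sigma]mulrC lerBrDl.
    by rewrite [z * sigma]mulrC lerBrDl.
  by rewrite -EFinD; congr _%:E; rewrite ![2^-1 * _]mulrC.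
transitivity (\int[distribution P Zm]_x g x)%E.
  by rewrite ge0_integral_distribution.
rewrite (eq_measure_integral nu) => [|A mA _]; last exact: law.
have e1 : (\int[nu1]_x g x = 2^-1%:E * \int[gam]_z g z)%E.
  exact: (@ge0_integral_mscale _ _ _ gam _ measurableT half).
have e2 : (\int[nu2]_x g x = 2^-1%:E * \int[gam]_z g (m + sigma * z)%R)%E.
  transitivity (2^-1%:E * \int[distribution gam am]_x g x)%E.
    exact: (@ge0_integral_mscale _ _ _ (distribution gam am) _ measurableT half).
  by congr (_ * _)%E; exact: ge0_integral_distribution.
transitivity (\int[nu1]_x g x + \int[nu2]_x g x)%E.
  by apply: ge0_integral_measure_add.
rewrite e1 e2.
by rewrite -ge0_muleDr//; apply: integral_ge0.
Qed.

End mixture.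

(** * Exponents *)

Section exponents.
Context {R : realType}.
Variables (a sigma beta : R).
Hypotheses (sigma_gt0 : 0 < sigma) (sigma_neq1 : sigma != 1) (beta_gt0 : 0 < beta).

(** Logarithm, divided by [n], of the Laplace transform at [q * beta * sqrt n] of N(0,1); for
    [rate2], of the normal law with mean [sqrt n * a] and variance [sigma ^+ 2]. *)
Definition rate1 (q : R) : R := q ^+ 2 * beta ^+ 2 / 2.
Definition rate2 (q : R) : R := q * (beta * a) + q ^+ 2 * (beta ^+ 2 * sigma ^+ 2) / 2.
Definition rate (q : R) : R := Num.max (rate1 q) (rate2 q).

Let r : R := Num.sqrt 2.
Let r0 : 0 < r. Proof. by rewrite sqrtr_gt0. Qed.
Let r2 : r * r = 2. Proof. by rewrite -expr2 sqr_sqrtr. Qed.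

(** One conjunct per component: it is either subcritical or strictly dominated in the second moment.
    Domination takes this form because [rate2 2 - rate1 2 = 2 * beta * (a - beta * (1 - sigma ^+
    2))]. *)
Lemma subcritical : [|| region1 a sigma, region2 a sigma | region3 a sigma] ->
  beta < beta_plus a sigma / 2 ->
  (2 * beta ^+ 2 < 1 \/ beta * (1 - sigma ^+ 2) < a) /\
  (2 * (beta ^+ 2 * sigma ^+ 2) < 1 \/ a < beta * (1 - sigma ^+ 2)).
Proof.
have sq (x : R) : 0 < x -> x * r < 1 -> 2 * x ^+ 2 < 1.
  move=> x0 xr; have -> : 2 * x ^+ 2 = (x * r) ^+ 2 by rewrite exprMn -r2; ring.
  by rewrite expr_lt1// mulr_ge0// ltW.
have bs0 : 0 < beta * sigma by rewrite mulr_gt0.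
have rs0 : 0 < r * sigma by rewrite mulr_gt0.
have half (x : R) : 0 < x -> beta < r / x / 2 -> beta * x * r < 1.
  move=> x0; rewrite -(ltr_pM2r x0) => H.
  have H2 : beta * x < r / 2.
    apply: lt_le_trans H _; rewrite le_eqVlt; apply/orP; left.
    by apply/eqP; field; rewrite gt_eqF.
  by rewrite -(ltr_pM2r r0) in H2; apply: lt_le_trans H2 _; rewrite mulrAC r2 divff.
have s12 : sigma < 1 \/ 1 < sigma.
  by move: sigma_neq1; rewrite neq_lt => /orP[]; [left|right].
rewrite /beta_plus; case: ifPn => [R1 _|_].
  (* In region 1 the bound on [beta] makes the second component subcritical. The first one is
     dominated if [sigma < 1], by the lower bound on [a], and subcritical if [sigma > 1], as then
     [beta < beta * sigma]. *)
  move=> /half-/(_ sigma_gt0) H.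
  have S2 : 2 * (beta ^+ 2 * sigma ^+ 2) < 1 by rewrite -exprMn; apply: sq.
  split; last by left.
  case: s12 => s1.
    right; move: R1; rewrite /region1 ltr_pdivrMr// => R1.
    have : 0 < 1 - sigma ^+ 2 by rewrite subr_gt0 expr_lt1// ltW.
    set D := 1 - _ in R1 *  => D0.
    rewrite -(ltr_pM2r rs0); apply: le_lt_trans R1.
    have -> : beta * D * (r * sigma) = D * (beta * sigma * r) by ring.
    by rewrite ler_piMr// ltW.
  left; apply: sq => //; apply: le_lt_trans H.
  by rewrite ler_pM2r// ler_pMr// ltW.
case: ifPn => [/andP[R2a R2b] _ H|_].
  (* In region 2, [beta_plus a sigma / 2] is the [beta] at which the second moments balance. Below
     it the second component dominates if [sigma < 1] and the first if [sigma > 1]; the bounds on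
     [a] make the dominating one subcritical. *)
  case: s12 => s1.
    have D0 : 0 < 1 - sigma ^+ 2 by rewrite subr_gt0 expr_lt1// ltW.
    have H2 : beta * (1 - sigma ^+ 2) < a.
      rewrite -ltr_pdivlMr//; apply: lt_le_trans H _; rewrite le_eqVlt; apply/orP; left.
      by apply/eqP; field; rewrite gt_eqF.
    split; first by right.
    left; rewrite -exprMn; apply: sq => //.
    move: R2b; rewrite ltr_pdivlMr// => R2b.
    rewrite -(ltr_pM2l D0) mulr1; apply: le_lt_trans R2b.
    have -> : (1 - sigma ^+ 2) * (beta * sigma * r) =
      beta * (1 - sigma ^+ 2) * (r * sigma) by ring.
    by rewrite ler_pM2r// ltW.
  have D0 : 0 < sigma ^+ 2 - 1 by rewrite subr_gt0 expr_gt1// ltW.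
  have H2 : a < beta * (1 - sigma ^+ 2).
    rewrite -ltrN2 -mulrN opprB -ltr_pdivlMr//; apply: lt_le_trans H _.
    rewrite le_eqVlt; apply/orP; left.
    have Dn : 1 - sigma ^+ 2 != 0 by rewrite -oppr_eq0 opprB gt_eqF.
    by apply/eqP; field; rewrite Dn gt_eqF.
  split; last by right.
  left; apply: sq => //.
  move: R2a; rewrite ltr_pdivrMr// => R2a.
  rewrite -(ltr_pM2r D0) mul1r.
  have -> : beta * r * (sigma ^+ 2 - 1) = - (beta * (1 - sigma ^+ 2) * r) by ring.
  rewrite -[ltRHS]opprB ltrN2; apply: lt_trans R2a _.
  by rewrite ltr_pM2r.
case: ifPn => [R3 _ H|//].
(* Region 3 mirrors region 1: the first component is subcritical, and the second is subcritical if
   [sigma < 1], dominated if [sigma > 1]. *)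
have H1 : beta * r < 1.
  by rewrite -(ltr_pM2r r0) in H; apply: lt_le_trans H _; rewrite mulrAC r2 divff.
split; first by left; apply: sq.
case: s12 => s1.
  left; rewrite -exprMn; apply: sq => //; apply: le_lt_trans H1.
  by rewrite ler_pM2r// ler_piMr// ltW.
right; move: R3; rewrite /region3 ltr_pdivlMr// => R3.
have D0 : 0 < sigma ^+ 2 - 1 by rewrite subr_gt0 expr_gt1// ltW.
rewrite -(ltr_pM2r r0); apply: lt_le_trans R3 _.
rewrite -lerN2 opprB.
have -> : - (beta * (1 - sigma ^+ 2) * r) = beta * r * (sigma ^+ 2 - 1) by ring.
by rewrite ler_piMl// ltW.
Qed.

(* [M + x / 2 + x * M / 2] is [p * (1 + M) / 2 - 1] at [p = 2 + x], and the
   left-hand side is a rate with value [u] at 2 and quadratic coefficient [b / 2]. *)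
Let small_exponent (u b M : R) : u <= M -> 0 <= b -> (2 * b < 1 \/ u < M) ->
  exists2 e, 0 < e & forall x, 0 < x -> x <= e -> x <= 1 ->
    u + x * (u / 2 + b) + x ^+ 2 * b / 2 < M + x / 2 + x * M / 2.
Proof.
move=> uM b0 [b1|uM'].
  (* The right side minus the left is [(M - u) * (1 + x / 2) + x * (1 / 2 - b - x * b / 2)]. This
     witness makes the second term positive; in the other case the witness lets [M - u] absorb
     it. *)
  exists ((1 - 2 * b) / (b + 1)); first by rewrite divr_gt0//; lra.
  move=> x x0; rewrite ler_pdivlMr; last by lra.
  move=> H x1.
  have H2 : b + x * b / 2 < 1 / 2 by nra.
  have := ltr_pM2l x0 (b + x * b / 2) (1 / 2); rewrite H2 => H3.
  nra.
exists ((M - u) / (2 * (b + 1))); first by rewrite divr_gt0//; lra.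
move=> x x0; rewrite ler_pdivlMr; last by lra.
move=> H x1.
have : x ^+ 2 * b <= x * b by rewrite ler_wpM2r// expr2 ler_piMl// ltW.
have : 0 <= x * b by rewrite mulr_ge0// ltW.
have : x * u <= x * M by rewrite ler_wpM2l// ltW.
nra.
Qed.

Lemma lyapunov_exponent : [|| region1 a sigma, region2 a sigma | region3 a sigma] ->
  beta < beta_plus a sigma / 2 ->
  exists2 p, 2 <= p <= 3 & 1 + rate p < p * (1 + rate 2) / 2.
Proof.
move=> reg blt; have [c1 c2] := subcritical reg blt.
have M1 : rate1 2 <= rate 2 by rewrite /rate le_max lexx.
have M2 : rate2 2 <= rate 2 by rewrite /rate le_max lexx orbT.
have e1 : rate1 2 = 2 * beta ^+ 2 by rewrite /rate1; lra.
have e2 : rate2 2 = 2 * (beta * a) + 2 * (beta ^+ 2 * sigma ^+ 2) by rewrite /rate2; lra.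
have dE : rate2 2 - rate1 2 = 2 * beta * (a - beta * (1 - sigma ^+ 2)) by rewrite e1 e2; ring.
have b20 : 0 < 2 * beta by rewrite mulr_gt0.
have [|d1 d10 H1] := small_exponent M1 (sqr_ge0 beta).
  case: c1 => c1; [by left|right].
  apply: lt_le_trans M2; rewrite -subr_gt0 dE mulr_gt0//; lra.
have [|d2 d20 H2] := small_exponent M2 (mulr_ge0 (sqr_ge0 beta) (sqr_ge0 sigma)).
  case: c2 => c2; [by left|right].
  apply: lt_le_trans M1; rewrite -subr_lt0 dE pmulr_rlt0//; lra.
(* One [x] must serve both components; the 1 keeps [p = 2 + x] at most 3. *)
pose x := Num.min d1 (Num.min d2 1).
have x0 : 0 < x by rewrite !lt_min d10 d20 ltr01.
have xd1 : x <= d1 by rewrite ge_min lexx.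
have xd2 : x <= d2 by rewrite !ge_min lexx orbT.
have x1 : x <= 1 by rewrite !ge_min lexx !orbT.
exists (2 + x); first by apply/andP; split; lra.
have := H1 x x0 xd1 x1; have := H2 x x0 xd2 x1.
rewrite e1 e2; set M := rate 2 => h2 h1.
rewrite -ltrBrDl gt_max; apply/andP; split.
  by rewrite /rate1; lra.
by rewrite /rate2; lra.
Qed.

End exponents.

(** * Lyapunov's theorem for nonnegative i.i.d. rows *)

Section ge0_integrable.
Context {R : realType} {d : measure_display} {T : measurableType d}.
Variable P : probability T R.

Lemma ge0_integrable (f : T -> R) (r : R) : measurable_fun setT f ->
  (forall x, 0 <= f x) -> (\int[P]_x (f x)%:E = r%:E)%E ->
  P.-integrable setT (EFin \o f).
Proof.
move=> mf f0 E; apply/integrableP; split; first exact/measurable_EFinP.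
by under eq_integral do rewrite /= ger0_norm//; rewrite E ltry.
Qed.

Definition affine_rv (m D : R) (X : {RV P >-> R}) (w : T) : R := (X w - m) / D.

Let measurable_affine_rv m D X : measurable_fun setT (affine_rv m D X).
Proof.
by apply: measurable_funM => //; apply: measurable_funB => //; exact: measurable_funPT.
Qed.

HB.instance Definition _ m D X :=
  isMeasurableFun.Build _ _ _ _ (affine_rv m D X) (measurable_affine_rv m D X).

End ge0_integrable.

Section nonneg_iid.
Context {R : realType} {d : measure_display} {T : measurableType d}.
Variables (P : probability T R) (X : nat -> {RV P >-> R}).
Hypothesis Xind : mutually_independent P X.
Hypothesis X0 : forall j w, 0 <= X j w.
Variables m1 m2 : R.
Hypothesis EX1 : forall j, (\int[P]_w (X j w)%:E = m1%:E)%E.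
Hypothesis EX2 : forall j, (\int[P]_w (X j w ^+ 2)%:E = m2%:E)%E.

Lemma psum_ge0 N w : 0 <= psum X N w.
Proof. by apply: sumr_ge0 => j _; exact: X0. Qed.

Let mX j : measurable_fun setT (X j). Proof. exact: measurable_funPT. Qed.
Let mS N : measurable_fun setT (psum X N).
Proof. exact: (@measurable_funPT _ _ _ _ (psum X N)). Qed.
Let mX2 j : measurable_fun setT (fun w => X j w ^+ 2).
Proof. exact: measurable_funX. Qed.
Let mS2 N : measurable_fun setT (fun w => psum X N w ^+ 2).
Proof. by apply: measurable_funX; exact: mS. Qed.

Lemma integral_psum N : (\int[P]_w (psum X N w)%:E = (N%:R * m1)%:E)%E.
Proof.
elim: N => [|N IH].
  by under eq_integral do rewrite /psum big_ord0; rewrite integral0 mul0r.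
under eq_integral do rewrite psumS EFinD.
rewrite ge0_integralD//; last 4 first.
- by move=> w _; rewrite lee_fin psum_ge0.
- by apply/measurable_EFinP; exact: mS.
- by move=> w _; rewrite lee_fin X0.
- by apply/measurable_EFinP; exact: mX.
by rewrite [X in (X + _)%E]IH [X in (_ + X)%E]EX1 -EFinD -natr1 mulrDl mul1r.
Qed.

Lemma integral_psum_mul N : (\int[P]_w (psum X N w * X N w)%:E = (N%:R * m1 * m1)%:E)%E.
Proof.
(* The decoupling lemma asks for a function nonnegative on the whole plane, whereas the product is
   nonnegative only at the values taken. *)
transitivity (\int[P]_w (`|psum X N w * X N w|)%:E)%E.
  by apply: eq_integral => w _; rewrite ger0_norm// mulr_ge0// psum_ge0.
rewrite (@ge0_expectation_psumS _ _ _ P X Xind N (fun q => `|q.1 * q.2|%:E)) /=; last 2 first.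
- apply/measurable_EFinP; apply: measurableT_comp => //.
  by apply: measurable_funM; [exact: measurable_fst|exact: measurable_snd].
- by move=> q; rewrite lee_fin.
transitivity (\int[P]_w ((psum X N w)%:E * m1%:E))%E.
  apply: eq_integral => w _; rewrite -(EX1 N) -ge0_integralZl//.
  - by apply: eq_integral => v _; rewrite ger0_norm ?EFinM// mulr_ge0// psum_ge0.
  - by apply/measurable_EFinP; exact: mX.
  - by move=> v _; rewrite lee_fin X0.
  - by rewrite lee_fin psum_ge0.
rewrite ge0_integralZr//.
- by rewrite [X in (X * _)%E]integral_psum -EFinM.
- by apply/measurable_EFinP; exact: mS.
- by move=> w _; rewrite lee_fin psum_ge0.
- by rewrite -(EX1 0); apply: integral_ge0 => w _; rewrite lee_fin.
Qed.

Lemma integral_psum_sqr N :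
  (\int[P]_w (psum X N w ^+ 2)%:E = (N%:R * m2 + N%:R * (N%:R - 1) * m1 ^+ 2)%:E)%E.
Proof.
elim: N => [|N IH].
  under eq_integral do rewrite /psum big_ord0 expr0n/=.
  by rewrite integral0 !mul0r addr0.
under eq_integral do rewrite psumS sqrrD -addrA EFinD EFinD -mulr_natl.
rewrite ge0_integralD//; last 4 first.
- by move=> w _; rewrite lee_fin sqr_ge0.
- by apply/measurable_EFinP; exact: mS2.
- by move=> w _; rewrite -EFinD lee_fin addr_ge0 ?sqr_ge0// !mulr_ge0// psum_ge0.
- rewrite (_ : (fun _ => _) =
    (fun w => (2%:R * (psum X N w * X N w) + X N w ^+ 2)%:E)); last first.
    by [].
  apply/measurable_EFinP; apply: measurable_funD; last exact: mX2.
  by apply: measurable_funM => //; apply: measurable_funM; [exact: mS|exact: mX].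
rewrite ge0_integralD//; last 4 first.
- by move=> w _; rewrite lee_fin !mulr_ge0// psum_ge0.
- apply/measurable_EFinP; apply: measurable_funM => //.
  by apply: measurable_funM; [exact: mS|exact: mX].
- by move=> w _; rewrite lee_fin sqr_ge0.
- by apply/measurable_EFinP; exact: mX2.
under [X in (_ + (X + _))%E]eq_integral do rewrite EFinM.
rewrite ge0_integralZl//; last 2 first.
- by apply/measurable_EFinP; apply: measurable_funM; [exact: mS|exact: mX].
- by move=> w _; rewrite lee_fin mulr_ge0// psum_ge0.
rewrite [X in (X + _)%E]IH [X in (_ * X)%E]integral_psum_mul [X in (_ + (_ + X))%E]EX2.
by rewrite -EFinM -!EFinD -natr1; congr _%:E; ring.
Qed.

Lemma expectation_psum N : ('E_P[psum X N] = (N%:R * m1)%:E)%E.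
Proof. by rewrite unlock integral_psum. Qed.

Lemma variance_psum N : ('V_P[psum X N] = (N%:R * (m2 - m1 ^+ 2))%:E)%E.
Proof.
rewrite /variance unlock expectation_psum unlock /=.
have iS := ge0_integrable (mS N) (psum_ge0 N) (integral_psum N).
have iS2 := ge0_integrable (mS2 N) (fun w => sqr_ge0 _) (integral_psum_sqr N).
set k := N%:R * m1.
transitivity (\int[P]_w ((psum X N w ^+ 2)%:E + ((- 2 * k * psum X N w)%:E + (k ^+ 2)%:E)))%E.
  apply: eq_integral => w _; rewrite -!EFinD; congr _%:E.
  transitivity ((psum X N w - k) * (psum X N w - k)); [by []|ring].
have ilin : P.-integrable setT (fun w => (- 2 * k * psum X N w)%:E).
  exact: integrable_EFinZl.
have icst : P.-integrable setT (fun w => (k ^+ 2)%:E) by exact: integrable_EFin_cst.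
rewrite integralD//; last by apply: integrableD.
rewrite integralD//.
under [X in (_ + (X + _))%E]eq_integral do rewrite EFinM.
rewrite integralZl// integral_cst// [X in (_ + (_ + _ * X))%E](_ : _ = 1%E);
  last exact: probability_setT.
rewrite mule1 [X in (X + _)%E]integral_psum_sqr [X in (_ + (_ * X + _))%E]integral_psum.
by rewrite -EFinM -!EFinD; congr _%:E; rewrite /k; ring.
Qed.

Variables (N : nat) (p mp : R).
Hypothesis N0 : (0 < N)%N.
Hypothesis p23 : 2 <= p <= 3.
Hypothesis EXp : forall j, (\int[P]_w (X j w `^ p)%:E = mp%:E)%E.
Hypothesis v0 : 0 < m2 - m1 ^+ 2.

Let D : R := Num.sqrt (N%:R * (m2 - m1 ^+ 2)).
Let Y (j : nat) : {RV P >-> R} := affine_rv m1 D (X j).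

Let D0 : 0 < D. Proof. by rewrite sqrtr_gt0 mulr_gt0// ltr0n. Qed.
Let D2 : D ^+ 2 = N%:R * (m2 - m1 ^+ 2).
Proof. by rewrite sqr_sqrtr// mulr_ge0// ltW. Qed.
Let m10 : 0 <= m1.
Proof. by rewrite -lee_fin -(EX1 0); apply: integral_ge0 => w _; rewrite lee_fin. Qed.
Let p0 : 0 <= p. Proof. by case/andP: p23; lra. Qed.

Let mXp j : measurable_fun setT (fun w => X j w `^ p).
Proof. exact: (measurableT_comp (measurable_powR p) (mX j)). Qed.

Let iX j := ge0_integrable (mX j) (X0 j) (EX1 j).
Let iX2 j := ge0_integrable (mX2 j) (fun w => sqr_ge0 _) (EX2 j).
Let iXp j := ge0_integrable (mXp j) (fun w => powR_ge0 _ _) (EXp j).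

Lemma standardize_psum w : standardize P (psum X N) w = psum Y N w.
Proof.
rewrite /standardize expectation_psum variance_psum /= -/D /psum /Y /affine_rv.
rewrite -mulr_suml; congr (_ / _).
by rewrite sumrB sumr_const card_ord mulr_natl.
Qed.

Let Yind : mutually_independent P Y.
Proof.
move=> J B mB.
pose B' j : set R := (fun x => (x - m1) / D) @^-1` B j.
have mB' j : j \in J -> measurable (B' j).
  move=> jJ; rewrite -[B' j]setTI.
  apply: (_ : measurable_fun setT (fun x : R => (x - m1) / D)) => //; last exact: mB.
  by apply: measurable_funM => //; exact: measurable_funB.
exact: (Xind mB').
Qed.

Let EY1 j : \int[P]_w Y j w = 0.
Proof.
transitivity (\int[P]_w (D^-1 * X j w - D^-1 * m1)).
  by apply: eq_Rintegral => w _; rewrite -mulrBr mulrC.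
have i1 : P.-integrable setT (EFin \o (fun w => D^-1 * X j w)) by exact: integrable_EFinZl.
have i2 : P.-integrable setT (EFin \o (fun w : T => D^-1 * m1)) by exact: integrable_EFin_cst.
rewrite (RintegralB _ i1 i2)// (RintegralZl _ _ (iX j))// (Rintegral_cst_prob P).
by rewrite /Rintegral EX1 subrr.
Qed.

Let EY2 j : \int[P]_w (Y j w ^+ 2) = N%:R^-1.
Proof.
have -> : (fun w => Y j w ^+ 2) =
    (fun w => D ^- 2 * (X j w ^+ 2 + (- 2 * m1 * X j w + m1 ^+ 2))).
  by apply/funext => w; rewrite /Y /affine_rv exprMn exprVn; ring.
have ilin : P.-integrable setT (EFin \o (fun w => - 2 * m1 * X j w)) by exact: integrable_EFinZl.
have icst : P.-integrable setT (EFin \o (fun w : T => m1 ^+ 2)) by exact: integrable_EFin_cst.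
have ilc := integrable_EFinD ilin icst.
have iall := integrable_EFinD (iX2 j) ilc.
rewrite (RintegralZl _ _ iall)// (RintegralD _ (iX2 j) ilc)// (RintegralD _ ilin icst)//.
rewrite (RintegralZl _ _ (iX j))// (Rintegral_cst_prob P).
rewrite /Rintegral EX1 EX2 /= D2.
by field; rewrite !gt_eqF ?ltr0n//.
Qed.

Let YpE j w : `|Y j w| `^ p = D `^ (- p) * `|X j w - m1| `^ p.
Proof.
rewrite /Y /affine_rv normrM normfV (gtr0_norm D0) powRM ?invr_ge0 ?(ltW D0)//.
by rewrite mulrC -(powR_inv1 (ltW D0)) -powRrM mulN1r.
Qed.

(** As [X j w] and [m1] are nonnegative, [|X j w - m1|] is at most the larger of the two, so no
    factor depending on [p] arises. *)
Let Yp_le j w : `|Y j w| `^ p <= D `^ (- p) * (X j w `^ p + m1 `^ p).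
Proof.
rewrite YpE ler_wpM2l ?powR_ge0//.
have [h|h] := leP m1 (X j w).
  rewrite ger0_norm ?subr_ge0// (@le_trans _ _ (X j w `^ p))//.
    by rewrite ge0_ler_powR ?nnegrE ?subr_ge0// lerBlDr lerDl.
  by rewrite lerDl powR_ge0.
rewrite ler0_norm ?subr_le0 ?(ltW h)// opprB (@le_trans _ _ (m1 `^ p))//.
  by rewrite ge0_ler_powR ?nnegrE ?subr_ge0 ?(ltW h)// lerBlDr lerDl.
by rewrite lerDr powR_ge0.
Qed.

Let iYb j : P.-integrable setT (EFin \o (fun w => D `^ (- p) * (X j w `^ p + m1 `^ p))).
Proof.
apply: integrable_EFinZl; apply: integrable_EFinD; first exact: iXp.
exact: integrable_EFin_cst.
Qed.

Let iYp j : P.-integrable setT (EFin \o (fun w => `|Y j w| `^ p)).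
Proof.
apply: le_integrable (iYb j) => //.
  apply/measurable_EFinP; apply: (measurableT_comp (measurable_powR p)).
  by apply: measurableT_comp => //; exact: (@measurable_funPT _ _ _ _ (Y j)).
by move=> w _; rewrite lee_fin ger0_norm ?powR_ge0// (le_trans (Yp_le j w))// ler_norm.
Qed.

Let EYp j : \int[P]_w (`|Y j w| `^ p) <= D `^ (- p) * (mp + m1 `^ p).
Proof.
apply: (@le_trans _ _ (\int[P]_w (D `^ (- p) * (X j w `^ p + m1 `^ p)))).
  by apply: (le_Rintegral _ (iYp j) (iYb j)).
have icst : P.-integrable setT (EFin \o (fun w : T => m1 `^ p)) by exact: integrable_EFin_cst.
rewrite RintegralZl//; last by apply: integrable_EFinD => //; exact: iXp.
by rewrite (RintegralD _ (iXp j) icst)// (Rintegral_cst_prob P) /Rintegral EXp.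
Qed.

Local Notation gam := (@normal_prob R 0 1).

Lemma lyapunov_bound (f f1 f2 : R -> R) (C : R) :
  continuous f -> (forall x, 0 <= f x <= 1) -> 0 <= C ->
  (forall q x t, 2 <= q <= 3 ->
    `|f (x + t) - f x - t * f1 x - t ^+ 2 / 2 * f2 x| <= C * `|t| `^ q) ->
  let err := C * (N%:R * (D `^ (- p) * (mp + m1 `^ p)) +
    Num.sqrt N%:R^-1 * \int[gam]_z (`|z| ^+ 3)) in
  (\int[P]_w (f (standardize P (psum X N) w))%:E <= \int[gam]_z (f z)%:E + err%:E /\
   \int[gam]_z (f z)%:E <= \int[P]_w (f (standardize P (psum X N) w))%:E + err%:E)%E.
Proof.
move=> cf f01 C0 fT err.
have iY j : P.-integrable setT (EFin \o Y j).
  rewrite (_ : Y j = (fun w => D^-1 * (X j w + - m1)) :> (T -> R)); last first.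
    by apply/funext => w; rewrite mulrC.
  apply: integrable_EFinZl; apply: integrable_EFinD; first exact: iX.
  exact: integrable_EFin_cst.
have iY2 j : P.-integrable setT (EFin \o (fun w => Y j w ^+ 2)).
  rewrite (_ : (fun w => Y j w ^+ 2) =
    (fun w => D ^- 2 * (X j w ^+ 2 + (- 2 * m1 * X j w + m1 ^+ 2)))); last first.
    by apply/funext => w; rewrite /Y /affine_rv exprMn exprVn; ring.
  apply: integrable_EFinZl; apply: integrable_EFinD; first exact: iX2.
  by apply: integrable_EFinD; [apply: integrable_EFinZl; exact: iX|exact: integrable_EFin_cst].
have := @lindeberg_bound _ _ _ P Y Yind N p _ N0 p23 iY iY2 iYp EY1 EY2 EYp
  f f1 f2 C cf f01 C0 fT.
under eq_integral do rewrite -standardize_psum.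
have -> : N%:R * (C * (D `^ (- p) * (mp + m1 `^ p) + Num.sqrt N%:R^-1 ^+ 3 *
   \int[gam]_z (`|z| ^+ 3))) = err.
  (* The [N] Gaussian errors of size [s ^+ 3] sum to [s], because [N * s ^+ 2 = 1]. *)
  have E : N%:R * Num.sqrt N%:R^-1 ^+ 2 = 1 :> R.
    by rewrite sqr_sqrtr ?invr_ge0 ?ler0n// divff// pnatr_eq0 -lt0n.
  rewrite /err; set s := Num.sqrt _ in E *; set K := Rintegral _ _ _.
  have -> : C * (N%:R * (D `^ (- p) * (mp + m1 `^ p)) + s * K) =
    C * (N%:R * (D `^ (- p) * (mp + m1 `^ p)) + (N%:R * s ^+ 2) * s * K) by rewrite E mul1r.
  ring.
by [].
Qed.

End nonneg_iid.

(** Positive variance is asked only for large [n]: in the application the row [n = 0] is constant,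
    the exponent carrying the factor [sqrt 0]. *)
Lemma lyapunov_clt {R : realType} {d : nat -> measure_display}
    {T : forall n, measurableType (d n)} (P : forall n, probability (T n) R)
    (X : forall n, nat -> {RV (P n) >-> R}) (N : nat -> nat) (m1 m2 mp : nat -> R) (p : R) :
  (forall n, mutually_independent (P n) (X n)) ->
  (forall n j w, 0 <= X n j w) ->
  (forall n j, (\int[P n]_w (X n j w)%:E = (m1 n)%:E)%E) ->
  (forall n j, (\int[P n]_w (X n j w ^+ 2)%:E = (m2 n)%:E)%E) ->
  (forall n j, (\int[P n]_w (X n j w `^ p)%:E = (mp n)%:E)%E) ->
  2 <= p <= 3 ->
  (\forall n \near \oo, 0 < m2 n - m1 n ^+ 2) ->
  (forall n, (0 < N n)%N) ->
  (N n)%:R^-1 @[n --> \oo] --> (0 : R) ->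
  (N n)%:R * (Num.sqrt ((N n)%:R * (m2 n - m1 n ^+ 2)) `^ (- p) * (mp n + m1 n `^ p))
    @[n --> \oo] --> (0 : R) ->
  cvg_in_distribution P (fun n => standardize (P n) (psum (X n) (N n))) (normal_prob 0 1).
Proof.
move=> Xind X0 EX1 EX2 EXp p23 v0 N0 cN cL.
apply: cvg_in_distribution_logistic => lam c e e0.
have [C [C0 CT]] := logistic_taylor lam c.
pose err n : R := C * ((N n)%:R *
      (Num.sqrt ((N n)%:R * (m2 n - m1 n ^+ 2)) `^ (- p) * (mp n + m1 n `^ p)) +
    Num.sqrt (N n)%:R^-1 * \int[normal_prob 0 1]_z (`|z| ^+ 3)).
have cerr : err n @[n --> \oo] --> (0 : R).
  rewrite /err -[X in _ --> X](mulr0 C); apply: cvgM; first exact: cvg_cst.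
  rewrite -[X in _ --> X](addr0 0); apply: cvgD => //.
  rewrite -[X in _ --> X](mul0r (\int[normal_prob 0 1]_z (`|z| ^+ 3))).
  apply: cvgM; last exact: cvg_cst.
  rewrite -[X in _ --> X](@sqrtr0 R); apply: (cvg_comp _ _ cN).
  exact: sqrt_continuous.
near=> n.
have vn : 0 < m2 n - m1 n ^+ 2 by near: n.
have en : err n <= e.
  near: n; have /cvgrPdist_le/(_ e e0) := cerr.
  by apply: filterS => n; rewrite sub0r normrN; apply: le_trans; exact: ler_norm.
have f01 x : 0 <= logistic lam c x <= 1 by rewrite logistic_le1 ltW// logistic_gt0.
have [H1 H2] := lyapunov_bound (Xind n) (X0 n) (EX1 n) (EX2 n) (N0 n) p23 (EXp n) vn
  (@continuous_logistic R lam c) f01 C0 CT.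
split.
  by apply: le_trans H1 _; apply: leeD2l; rewrite lee_fin.
by apply: le_trans H2 _; apply: leeD2l; rewrite lee_fin.
Unshelve. all: by end_near. Qed.

(** * Exponentials of the mixture variables and their moments *)

Section exp_rv.
Context {R : realType} {d : measure_display} {T : measurableType d}.
Variable P : probability T R.

Definition exp_rv (k : R) (Z : {RV P >-> R}) (w : T) : R := expR (k * Z w).

Let measurable_exp_rv k Z : measurable_fun setT (exp_rv k Z).
Proof.
by apply: measurableT_comp => //; apply: measurable_funM => //; exact: measurable_funPT.
Qed.

HB.instance Definition _ k Z :=
  isMeasurableFun.Build _ _ _ _ (exp_rv k Z) (measurable_exp_rv k Z).

Lemma exp_rv_indep k (Z : nat -> {RV P >-> R}) : mutually_independent P Z ->
  mutually_independent P (fun j => exp_rv k (Z j)).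
Proof.
move=> Zind J B mB.
pose B' j : set R := (fun x => expR (k * x)) @^-1` B j.
have mB' j : j \in J -> measurable (B' j).
  move=> jJ; rewrite -[B' j]setTI.
  apply: (_ : measurable_fun setT (fun x : R => expR (k * x))) => //; last exact: mB.
  by apply: measurableT_comp => //; exact: mulrl_measurable.
exact: (Zind _ _ mB').
Qed.

Lemma integral_mixture_expR (Z : {RV P >-> R}) (m sigma t : R) : 0 < sigma ->
  (forall x, cdf Z x = (Phi x / 2 + Phi ((x - m) / sigma) / 2)%:E) ->
  (\int[P]_w (expR (t * Z w))%:E =
    ((expR (t ^+ 2 / 2) + expR (t * m + t ^+ 2 * sigma ^+ 2 / 2)) / 2)%:E)%E.
Proof.
move=> s0 law.
rewrite (@ge0_expectation_mixture _ _ _ P Z m sigma s0 law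
  (fun x => (expR (t * x))%:E)); last 2 first.
- by apply/measurable_EFinP; apply: measurableT_comp => //; exact: mulrl_measurable.
- by move=> x; rewrite lee_fin expR_ge0.
rewrite integral_gauss_expR.
under eq_integral do rewrite mulrDr mulrA expRD EFinM.
rewrite ge0_integralZl//; last first.
  by apply/measurable_EFinP; apply: measurableT_comp => //; exact: mulrl_measurable.
rewrite integral_gauss_expR -EFinM -expRD exprMn.
by congr _%:E; rewrite mulrC.
Qed.

End exp_rv.

Lemma expR_decay {R : realType} (c e : R) : 0 < c -> 0 < e ->
  \forall n \near \oo, expR (- (c * n%:R)) <= e.
Proof.
move=> c0 e0.
near=> n.
have H : (c * e)^-1 <= n%:R.
  near: n; exact: nbhs_infty_ger.
rewrite expRN -[leRHS]invrK lef_pV2 ?posrE ?invr_gt0 ?expR_gt0//.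
apply: (@le_trans _ _ (c * n%:R)); last by rewrite (le_trans _ (expR_ge1Dx _))// lerDr.
by rewrite -ler_pdivrMl// -invfM.
Unshelve. all: by end_near. Qed.

(** * Asymptotics of the truncated exponential sums *)

Section asymptotics.
Context {R : realType}.
Variables (a sigma beta : R).
Hypotheses (sigma_gt0 : 0 < sigma) (beta_gt0 : 0 < beta).

Local Notation rate1 := (@rate1 R beta).
Local Notation rate2 := (@rate2 R a sigma beta).
Local Notation rate := (@rate R a sigma beta).

Definition moment (n : nat) (q : R) : R :=
  (expR (n%:R * rate1 q) + expR (n%:R * rate2 q)) / 2.

Definition nterms (n : nat) : nat := Num.truncn (expR n%:R : R).

Lemma nterms_le n : (nterms n)%:R <= expR n%:R :> R.
Proof. by rewrite truncn_le ?expR_ge0. Qed.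

Lemma nterms_gt0 n : (0 < nterms n)%N.
Proof. by rewrite truncn_gt0 -[X in X <= _]expR0 ler_expR. Qed.

Lemma nterms_ge n : expR n%:R / 2 <= (nterms n)%:R :> R.
Proof.
have := @truncnS_gt R (expR n%:R); rewrite -/(nterms n) -natr1 => H.
have : 1 <= (nterms n)%:R :> R by rewrite ler1n nterms_gt0.
lra.
Qed.

Lemma moment_le n q : moment n q <= expR (n%:R * rate q).
Proof.
have : expR (n%:R * rate1 q) <= expR (n%:R * rate q).
  by rewrite ler_expR ler_wpM2l// /rate le_max lexx.
have : expR (n%:R * rate2 q) <= expR (n%:R * rate q).
  by rewrite ler_expR ler_wpM2l// /rate le_max lexx orbT.
rewrite /moment; lra.
Qed.

Lemma moment_ge n q : expR (n%:R * rate q) / 2 <= moment n q.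
Proof.
rewrite /moment ler_pM2r ?invr_gt0// /rate.
by have [_|_] := leP (rate1 q) (rate2 q); [rewrite lerDr expR_ge0|rewrite lerDl expR_ge0].
Qed.

Lemma moment_gt0 n q : 0 < moment n q.
Proof. by rewrite divr_gt0// addr_gt0// expR_gt0. Qed.

(** Jensen's inequality at the level of rates: the linear part is homogeneous and the quadratic part
    grows faster, as [p <= p ^+ 2]. It makes the centring term [m1 ^ p] no larger than the bound on
    the [p]-th moment. *)
Lemma rate_homo p : 1 <= p -> p * rate 1 <= rate p.
Proof.
move=> p1.
have pp : p <= p ^+ 2 by rewrite expr2 ler_peMl//; lra.
have b1 : 0 <= beta ^+ 2 by exact: sqr_ge0.
have b2 : 0 <= beta ^+ 2 * sigma ^+ 2 by rewrite mulr_ge0// sqr_ge0.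
rewrite /rate maxr_pMr; last by lra.
rewrite ge_max; apply/andP; split; rewrite le_max; apply/orP; [left|right].
  by rewrite /rate1; have := ler_wpM2r b1 pp; lra.
by rewrite /rate2; have := ler_wpM2r b2 pp; lra.
Qed.

Lemma moment1_powR n p : 1 <= p -> moment n 1 `^ p <= expR (n%:R * rate p).
Proof.
move=> p1; apply: (@le_trans _ _ (expR (n%:R * rate 1) `^ p)).
  by rewrite ge0_ler_powR ?nnegrE ?expR_ge0 ?(ltW (moment_gt0 _ _)) ?moment_le//; lra.
rewrite -expRM ler_expR -mulrA ler_wpM2l// mulrC; exact: rate_homo.
Qed.

(** By convexity of the square the components separate, and for each one [rate 2 - 2 * rate 1] is
    [beta ^+ 2], resp. [beta ^+ 2 * sigma ^+ 2]: an exponential gap. Hence the variance is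
    eventually at least half of the second moment. *)
Lemma moment1_sqr : \forall n \near \oo, moment n 1 ^+ 2 <= moment n 2 / 2.
Proof.
pose c : R := Num.min (beta ^+ 2) (beta ^+ 2 * sigma ^+ 2).
have c0 : 0 < c by rewrite lt_min exprn_gt0//= mulr_gt0// exprn_gt0.
near=> n.
have H : expR (- (c * n%:R)) <= 1 / 2.
  by near: n; apply: expR_decay => //; rewrite divr_gt0.
have n0 : 0 <= n%:R :> R by [].
have b1 : expR (n%:R * rate1 1) ^+ 2 <= expR (n%:R * rate1 2) / 2.
  rewrite -expRM_natr.
  apply: (@le_trans _ _ (expR (n%:R * rate1 2) * expR (- (c * n%:R)))); last first.
    by rewrite ler_pM2l ?expR_gt0// -[2^-1]mul1r.
  rewrite -expRD ler_expR /rate1.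
  have : c * n%:R <= beta ^+ 2 * n%:R by rewrite ler_wpM2r// ge_min lexx.
  by lra.
have b2 : expR (n%:R * rate2 1) ^+ 2 <= expR (n%:R * rate2 2) / 2.
  rewrite -expRM_natr.
  apply: (@le_trans _ _ (expR (n%:R * rate2 2) * expR (- (c * n%:R)))); last first.
    by rewrite ler_pM2l ?expR_gt0// -[2^-1]mul1r.
  rewrite -expRD ler_expR /rate2.
  have : c * n%:R <= beta ^+ 2 * sigma ^+ 2 * n%:R by rewrite ler_wpM2r// ge_min lexx orbT.
  by lra.
rewrite /moment; move: b1 b2.
set A1 := expR _; set B1 := expR _; set A2 := expR _; set B2 := expR _ => b1 b2.
have : ((A1 + A2) / 2) ^+ 2 <= (A1 ^+ 2 + A2 ^+ 2) / 2.
  by have := sqr_ge0 (A1 - A2); rewrite !expr2; lra.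
lra.
Unshelve. all: by end_near. Qed.

Lemma nterms_cvg : (nterms n)%:R^-1 @[n --> \oo] --> (0 : R).
Proof.
apply/cvgrPdist_le => e e0.
near=> n.
have H : expR (- (1 * n%:R)) <= e / 2.
  by near: n; apply: expR_decay => //; rewrite divr_gt0.
rewrite sub0r normrN ger0_norm ?invr_ge0//.
apply: (@le_trans _ _ (expR n%:R / 2)^-1).
  by rewrite lef_pV2 ?posrE ?nterms_ge ?divr_gt0 ?expR_gt0// ltr0n nterms_gt0.
rewrite invfM invrK -expRN; rewrite mul1r in H; lra.
Unshelve. all: by end_near. Qed.

Lemma lyapunov_cvg p : 2 <= p <= 3 -> 1 + rate p < p * (1 + rate 2) / 2 ->
  (nterms n)%:R * (Num.sqrt ((nterms n)%:R * (moment n 2 - moment n 1 ^+ 2)) `^ (- p) *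
     (moment n p + moment n 1 `^ p)) @[n --> \oo] --> (0 : R).
Proof.
move=> /andP[p2 p3] gap.
pose kap : R := p * (1 + rate 2) / 2 - (1 + rate p).
have kap0 : 0 < kap by rewrite subr_gt0.
have p0 : 0 <= p by lra.
apply/cvgrPdist_le => e e0.
(* The factor [3 ^ p] comes from [E / 3 <= D] and the 2 from the two terms [moment n p] and
   [moment n 1 ^ p]. *)
have e1 : 0 < e / (2 * 3 `^ p) by rewrite divr_gt0// mulr_gt0// powR_gt0.
near=> n.
have H : expR (- (kap * n%:R)) <= e / (2 * 3 `^ p).
  by near: n; exact: expR_decay.
have V : moment n 1 ^+ 2 <= moment n 2 / 2 by near: n; exact: moment1_sqr.
set D := Num.sqrt _.
pose E : R := expR (n%:R * (1 + rate 2) / 2).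
have E0 : 0 < E by exact: expR_gt0.
have E2 : E ^+ 2 = expR n%:R * expR (n%:R * rate 2).
  by rewrite -expRM_natr -expRD; congr expR; lra.
(* Truncation costs a factor 2 and the variance bound a factor 4, so [D ^+ 2 >= E ^+ 2 / 8], and
   [1 / 8 >= 1 / 9]. *)
have DE : E / 3 <= D.
  rewrite -[leLHS]ger0_norm ?divr_ge0 ?(ltW E0)// -sqrtr_sqr ler_wsqrtr//.
  rewrite exprMn exprVn E2.
  have h1 := nterms_ge n; have h2 := moment_ge n 2.
  have x0 := expR_gt0 (n%:R : R); have y0 := expR_gt0 (n%:R * rate 2).
  have h3 : expR (n%:R * rate 2) / 4 <= moment n 2 - moment n 1 ^+ 2 by lra.
  apply: (@le_trans _ _ (expR n%:R / 2 * (expR (n%:R * rate 2) / 4))).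
    have xy : 0 <= expR n%:R * expR (n%:R * rate 2) by rewrite mulr_ge0// ltW.
    lra.
  by rewrite ler_pM// divr_ge0// ltW.
have DP : D `^ (- p) <= 3 `^ p * expR (- (p * (n%:R * (1 + rate 2) / 2))).
  rewrite powRN expRN -[3 `^ p]invrK -invfM lef_pV2 ?posrE ?powR_gt0//; last 2 first.
  - by apply: lt_le_trans DE; rewrite divr_gt0.
  - by rewrite mulr_gt0 ?invr_gt0 ?powR_gt0 ?expR_gt0.
  apply: (@le_trans _ _ ((E / 3) `^ p)); last first.
    by rewrite ge0_ler_powR ?nnegrE// ?divr_ge0 ?(ltW E0)// sqrtr_ge0.
  rewrite powRM ?invr_ge0 ?(ltW E0)// /E -expRM mulrC [X in expR X]mulrC.
  by rewrite -(powR_inv1 (ler0n R 3)) -powRrM mulN1r powRN.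
have Mp : moment n p + moment n 1 `^ p <= 2 * expR (n%:R * rate p).
  have p1 : 1 <= p by lra.
  have := moment_le n p; have := moment1_powR n p1; lra.
rewrite sub0r normrN ger0_norm; last first.
  by rewrite !mulr_ge0 ?powR_ge0// addr_ge0 ?powR_ge0// ltW// moment_gt0.
apply: (@le_trans _ _ (expR n%:R * (3 `^ p * expR (- (p * (n%:R * (1 + rate 2) / 2))) *
   (2 * expR (n%:R * rate p))))).
  rewrite ler_pM ?nterms_le//.
    by rewrite mulr_ge0 ?powR_ge0// addr_ge0 ?powR_ge0// ltW// moment_gt0.
  by rewrite ler_pM ?powR_ge0// addr_ge0 ?powR_ge0// ltW// moment_gt0.
have -> : expR n%:R * (3 `^ p * expR (- (p * (n%:R * (1 + rate 2) / 2))) *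
    (2 * expR (n%:R * rate p))) =
  2 * 3 `^ p * (expR n%:R * expR (- (p * (n%:R * (1 + rate 2) / 2))) *
    expR (n%:R * rate p)) by ring.
rewrite -!expRD.
have -> : n%:R + - (p * (n%:R * (1 + rate 2) / 2)) + n%:R * rate p = - (kap * n%:R).
  by rewrite /kap; lra.
by rewrite mulrC -ler_pdivlMr// mulr_gt0// powR_gt0.
Unshelve. all: by end_near. Qed.

End asymptotics.

Theorem theorem4p2 (R : realType) (a sigma : R)
    (sigma_gt0 : 0 < sigma) (sigma_neq1 : sigma != 1)
    (d : nat -> measure_display) (T : forall n, measurableType (d n))
    (P : forall n, probability (T n) R)
    (Z : forall n, nat -> {RV (P n) >-> R})
    (Z_indep : forall n, mutually_independent (P n) (Z n))
    (Z_law : forall n j x, cdf (Z n j) x = (mixture_cdf a sigma n x)%:E)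
    (a_sigma_regions : [|| region1 a sigma, region2 a sigma | region3 a sigma])
    (beta : R) (beta_gt0 : 0 < beta) (beta_lt : beta < beta_plus a sigma / 2) :
  cvg_in_distribution P (fun n => standardize (P n) (exp_sum n beta (Z n)))
    (normal_prob 0 1).
Proof.
have [p p23 gap] := lyapunov_exponent sigma_gt0 sigma_neq1 beta_gt0 a_sigma_regions beta_lt.
pose k n : R := beta * Num.sqrt n%:R.
pose X n j : {RV (P n) >-> R} := exp_rv (k n) (Z n j).
have k2 n : k n ^+ 2 = beta ^+ 2 * n%:R by rewrite exprMn sqr_sqrtr.
have km n : k n * (Num.sqrt n%:R * a) = beta * a * n%:R.
  have -> : k n * (Num.sqrt n%:R * a) = beta * a * Num.sqrt n%:R ^+ 2 by rewrite /k; ring.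
  by rewrite sqr_sqrtr.
have mom n j q : (\int[P n]_w (expR (q * k n * Z n j w))%:E = (moment a sigma beta n q)%:E)%E.
  rewrite (integral_mixture_expR _ sigma_gt0 (Z_law n j)) exprMn k2 -mulrA km.
  by congr ((expR _ + expR _) / 2)%:E; rewrite /rate1 /rate2; ring.
have EX1 n j : (\int[P n]_w (X n j w)%:E = (moment a sigma beta n 1)%:E)%E.
  by rewrite -(mom n j); apply: eq_integral => w _; rewrite mul1r.
have EX2 n j : (\int[P n]_w (X n j w ^+ 2)%:E = (moment a sigma beta n 2)%:E)%E.
  by rewrite -(mom n j); apply: eq_integral => w _; rewrite -expRM_natl mulrA.
have EXp n j : (\int[P n]_w (X n j w `^ p)%:E = (moment a sigma beta n p)%:E)%E.
  by rewrite -(mom n j); apply: eq_integral => w _; rewrite -mulrA mulrC expRM.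
have var0 : \forall n \near \oo, 0 < moment a sigma beta n 2 - moment a sigma beta n 1 ^+ 2.
  apply: filterS (moment1_sqr a sigma_gt0 beta_gt0) => n H.
  by have := @moment_gt0 R a sigma beta n 2; lra.
have := @lyapunov_clt R d T P X (@nterms R) _ _ _ p
  (fun n => exp_rv_indep (k n) (Z_indep n)) (fun n j w => expR_ge0 _) EX1 EX2 EXp p23 var0
  (@nterms_gt0 R) (@nterms_cvg R) (lyapunov_cvg sigma_gt0 beta_gt0 p23 gap).
(* The sum [exp_sum n beta (Z n)] is convertible to [psum (X n) (nterms n)]. *)
exact.
Qed.
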